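(* Let $S=K[X_1,\ldots,X_n]$ be the polynomial ring in $n$ variables over a field $K$ (not necessarily of positive characteristic). Let $I\subset S$ be an ideal, $<$ a monomial order on $S$, and let $h=\max\{\mathrm{ht}(\mathfrak p):\mathfrak p\in \mathrm{Min}(I)\}$. If $\mathrm{in}_<(I^{(h)})$ contains a squarefree monomial, then $\mathrm{in}_<(\sqrt I)$ is a squarefree monomial ideal.
   Context: $\mathrm{Min}(I)$ is the set of minimal prime ideals of $I$ and $\mathrm{ht}$ denotes height. For an ideal $I$ of a Noetherian ring $R$, the $m$th symbolic power is $I^{(m)}:=I^m(T^{-1}R)\cap R$, where $T$ is the complement in $R$ of the union of the minimal prime ideals of $I$; that is, $r\in I^{(m)}$ if and only if there is $x\in R$ avoiding all minimal prime ideals of $I$ such that $rx\in I^m$. For an ideal $J\subset S$, $\mathrm{in}_<(J)$ is the ideal generated by the initial monomials $\mathrm{in}_<(f)$ of the elements $f\in J$. A squarefree monomial ideal is an ideal generated by squarefree monomials. *)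

(* Defs.v *)
From HB Require Import structures.
From mathcomp Require Import all_boot all_order all_algebra.
From mathcomp Require Import boolp classical_sets.
From mathcomp Require Import mpoly.

Set Implicit Arguments.
Unset Strict Implicit.
Unset Printing Implicit Defensive.

Import GRing.Theory.
Local Open Scope classical_set_scope.
Local Open Scope ring_scope.

(* The ideals of [ring_quotient] ([idealr]) are proper and boolean; here an
   ideal is any subset closed under the ideal operations, the whole ring
   included. *)

Section Ideals.
Variable R : comNzRingType.
Implicit Types (I J P Q G : set R) (r x y : R) (k m h : nat).

Definition is_ideal I : Prop :=
  [/\ I 0,
      forall x y, I x -> I y -> I (x + y)
    & forall r x, I x -> I (r * x)].

Definition ideal_gen G : set R := smallest is_ideal G.

Definition ideal_mul I J : set R := ideal_gen [set x * y | x in I & y in J].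

(* [ideal_exp I 0] is the unit ideal. *)
Definition ideal_exp I m : set R := iter m (ideal_mul I) setT.

Definition radical I : set R := [set r | exists k, I (r ^+ k)].

Definition is_prime P : Prop :=
  [/\ is_ideal P, ~ P 1 & forall x y, P (x * y) -> P x \/ P y].

Definition minimal_prime I P : Prop :=
  [/\ is_prime P, I `<=` P
    & forall Q, is_prime Q -> I `<=` Q -> Q `<=` P -> Q = P].

(* Strict chain of primes c 0 < c 1 < ... < c k = P. Only the values of [c] at
   0, ..., k matter. *)
Definition prime_chain (c : nat -> set R) k P : Prop :=
  [/\ forall i, (i <= k)%N -> is_prime (c i),
      forall i, (i < k)%N -> c i `<` c i.+1
    & c k = P].

Definition height_le P h : Prop :=
  forall c k, prime_chain c k P -> (k <= h)%N.

Definition has_height P h : Prop :=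
  (exists c, prime_chain c h P) /\ height_le P h.

(* h = max {ht P | P in Min(I)}. In particular Min(I) is nonempty, so I is a
   proper ideal. *)
Definition max_height_min_primes I h : Prop :=
  (exists2 P, minimal_prime I P & has_height P h) /\
  (forall P, minimal_prime I P -> height_le P h).

Definition symbolic_power I m : set R :=
  [set r | exists2 x, (forall P, minimal_prime I P -> ~ P x)
                    & ideal_exp I m (r * x)].

End Ideals.

Definition monomial_order n (le : rel 'X_{1..n}) : Prop :=
  [/\ [/\ reflexive le, antisymmetric le, transitive le & total le],
      forall m, le 0%MM m
    & forall m m1 m2, le m1 m2 -> le (m1 + m)%MM (m2 + m)%MM].

Definition squarefree_monom n (m : 'X_{1..n}) : Prop := forall i, (m i <= 1)%N.

Section Initial.
Variables (K : fieldType) (n : nat).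

(* 'X_[m] is the initial monomial of f; no m satisfies this when f = 0. *)
Definition initial_monom (le : rel 'X_{1..n}) (f : {mpoly K[n]})
    (m : 'X_{1..n}) : Prop :=
  m \in msupp f /\ forall m', m' \in msupp f -> le m' m.

Definition monom_ideal (M : set 'X_{1..n}) : set {mpoly K[n]} :=
  ideal_gen [set 'X_[m] | m in M].

Definition initial_ideal (le : rel 'X_{1..n}) (J : set {mpoly K[n]}) :
    set {mpoly K[n]} :=
  monom_ideal [set m | exists2 f, J f & initial_monom le f m].

Definition squarefree_monomial_ideal (J : set {mpoly K[n]}) : Prop :=
  exists2 M : set 'X_{1..n},
    (forall m, M m -> squarefree_monom m) & J = monom_ideal M.

End Initial.

(* Main.v *)
Require Import Defs.
From mathcomp Require Import all_boot all_algebra all_solvable all_field ring.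
From mathcomp Require Import boolp classical_sets.
From mathcomp Require Import mpoly ssrcomplements.

(* Write J for the radical of I. It suffices that u lies in in(J) whenever a
   power u^k does. Multiplying by a monomial, take f in I^(h) with leading
   monomial X_1...X_n, and g in J with leading monomial u^k.

   Over a finite field with c^q = c, q >= k, let Tr be the linear map sending
   X^(q m + q - 1) to X^m and the other monomials to 0, so that
   Tr(a^q b) = a Tr(b). Then Tr(f^(q-1) u^(q-k) g) has leading monomial u. If P
   is a minimal prime of I, then, locally at P, the ideal P is generated by h
   elements y_i, and f lies in (y)^h. So f^(q-1) g lies in (y)^(h(q-1)+1), which
   is contained in (y_1^q, ..., y_h^q), and the trace lies in (y). Thus the trace
   lies in J after multiplication by some theta independent of q, a
   nonzerodivisor modulo J.

   Over an arbitrary K, suppose that u is not in in(J). Division by Groebner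
   bases of J and J + (theta) yields a functional on K[X] vanishing on J, whose
   value at theta F is the coefficient of u in F when F has no monomial above u,
   and whose values on monomials lie in a finitely generated subring of K. That
   subring maps to a finite field, where the functional and the trace above
   contradict each other. *)

Set Implicit Arguments.
Unset Strict Implicit.
Unset Printing Implicit Defensive.

Import GRing.Theory.
Local Open Scope classical_set_scope.
Local Open Scope ring_scope.

(** * Specialization to finite fields *)

Lemma finField_ext_root (F : finFieldType) (p : {poly F}) :
  (1 < size p)%N ->
  exists (F' : finFieldType) (i : {rmorphism F -> F'}) (y : F'),
    root (map_poly i p) y.
Proof.
move=> sp; have p0 : p != 0 by rewrite -size_poly_gt0 (ltn_trans _ sp).
have [L [zs Dp _]] := FinSplittingFieldFor p0.
case: zs Dp => [|z zs] Dp.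
  move/eqp_size: Dp; rewrite size_map_poly big_nil size_poly1 => sp1.
  by rewrite sp1 in sp.
exists (FinFieldExtType L), (in_alg L : {rmorphism F -> L}), z.
rewrite (eqp_root Dp z) root_prod_XsubC mem_head //.
Qed.

Section Specialization.
Variable K : fieldType.

(** The map [b] factors through the subring [a(R)] of [K] and does not kill [a d]. Working with the
    kernel of [a] avoids forming that subring; carrying [d] along lets the property pass to
    polynomial rings. *)
Definition specializes (R : comNzRingType) : Prop :=
  forall (a : {rmorphism R -> K}) (d : R), a d != 0 ->
  exists (F : finFieldType) (b : {rmorphism R -> F}),
    (forall r, a r = 0 -> b r = 0) /\ b d != 0.

Lemma specializes_int : specializes int.
Proof.
move=> a d ad0.
have aE r : a r = r%:~R by rewrite -[r in LHS]intz rmorph_int.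
have d0 : d != 0 by apply: contraNneq ad0 => ->; rewrite rmorph0.
suff [p pp [pa pd]] : exists2 p, prime p &
    (forall r, a r = 0 -> (p %| `|r|)%N) /\ ~~ (p %| `|d|)%N.
  have Fp r : ((r%:~R : 'F_p) == 0) = (p %| `|r|)%N.
    have pc := pchar_Fp pp.
    rewrite (dvdn_pcharf pc); case: r => k; first by rewrite absz_nat.
    by rewrite NegzE abszN absz_nat rmorphN oppr_eq0.
  exists 'F_p, (intmul 1 : {rmorphism int -> 'F_p}); split.
    by move=> r /pa; rewrite -Fp => /eqP.
  by rewrite /= Fp.
have absa r : a r = 0 -> (`|r|%N)%:R = 0 :> K.
  rewrite aE; case: r => k; first by rewrite absz_nat.
  by rewrite NegzE abszN absz_nat rmorphN => /eqP; rewrite oppr_eq0 => /eqP.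
have absad : (`|d|%N)%:R != 0 :> K.
  move: ad0; rewrite aE; case: d {d0} => k; first by rewrite absz_nat.
  by rewrite NegzE abszN absz_nat rmorphN oppr_eq0.
have [[p pK]|noK] := pselect (exists p, p \in [pchar K]).
  exists p; first exact: pcharf_prime pK.
  split=> [r /absa/eqP|]; rewrite (dvdn_pcharf pK) //.
(* In characteristic 0 the map [a] is injective, and any prime larger than the absolute value of [d]
   will do. *)
have [p ltp pp] := prime_above `|d|%N.
exists p => //; split=> [r /absa|]; last by rewrite gtnNdvd ?absz_gt0.
have [->|r_gt0 /eqP r0] := posnP `|r|%N; first by rewrite dvdn0.
by have [q qK] := natf0_pchar r_gt0 r0; case: noK; exists q.
Qed.

(** * Specialization with one more variable *)

Section Poly.
Variable R : comNzRingType.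
Hypothesis specR : specializes R.
Variable a : {rmorphism {poly R} -> K}.
Let a0 : {rmorphism R -> K} := a \o polyC.
Let z (P : {poly R}) : {poly K} := map_poly a0 P.

Let aE P : a P = (z P).[a 'X].
Proof.
rewrite -[P in LHS]coefK poly_def rmorph_sum /=.
rewrite (@horner_coef_wide _ (size P)) ?size_poly //.
apply: eq_bigr => i _; rewrite -mul_polyC rmorphM rmorphXn /=.
by rewrite coef_map.
Qed.

Let zD P Q : z (P + Q) = z P + z Q. Proof. exact: rmorphD. Qed.
Let zB P Q : z (P - Q) = z P - z Q. Proof. exact: rmorphB. Qed.
Let zMu P Q : z (P * Q) = z P * z Q. Proof. exact: rmorphM. Qed.
Let zC c : z c%:P = (a0 c)%:P. Proof. exact: map_polyC. Qed.
Let zXn k : z 'X^k = 'X^k. Proof. exact: map_polyXn. Qed.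
Let zE P i : (z P)`_i = a0 P`_i. Proof. exact: coef_map. Qed.

Let az P Q : z P = z Q -> a P = a Q. Proof. by rewrite (aE P) (aE Q) => ->. Qed.

(** Degrees are measured in [K[X]], since [a0] may kill top coefficients. Hence the identity holds
    only after [z], and the multiplier is a power of the coefficient of [G] that becomes the leading
    one. *)
Lemma pseudo_div_along P G : z G != 0 ->
  exists k Q S, [/\ z ((G`_(size (z G)).-1 ^+ k)%:P * P) = z (Q * G + S)
                  & (size (z S) < size (z G))%N].
Proof.
move=> zG0; have sG : (0 < size (z G))%N by rewrite size_poly_gt0.
set g := G`_ _.
have [n] := ubnP (size (z P)); elim: n P => // n IH P; rewrite ltnS => sP.
have [ltPG|leGP] := ltnP (size (z P)) (size (z G)).
  by exists 0%N, 0, P; rewrite expr0 mul1r mul0r add0r.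
set p := P`_(size (z P)).-1.
set Q0 := p%:P * 'X^(size (z P) - size (z G)).
have [|k [Q [S [e sS]]]] := IH (g%:P * P - Q0 * G).
  apply: leq_trans sP; have sP0 : (0 < size (z P))%N by apply: leq_trans leGP.
  rewrite -(prednK sP0) ltnS; apply/leq_sizeP => j lej.
  rewrite zB !zMu !zC zXn -mulrA coefB !coefCM coefXnM.
  have -> : a0 g = lead_coef (z G) by rewrite lead_coefE zE.
  have -> : a0 p = lead_coef (z P) by rewrite lead_coefE zE.
  have lt1 : (j < size (z P) - size (z G))%N = false.
    apply/negP => h; have := leq_trans h (leq_subr _ _) => h'.
    have : (j < (size (z P)).-1.+1)%N by rewrite prednK.
    rewrite ltnS => h2.
    have ej : j = (size (z P)).-1 by apply/eqP; rewrite eqn_leq h2.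
    move: h; rewrite ej ltn_subRL addnC -ltn_subRL -{1}(prednK sP0) subSnn.
    by rewrite ltnS leqNgt sG.
  rewrite lt1.
  have [ej|nej] := eqVneq j (size (z P)).-1.
    have -> : (j - (size (z P) - size (z G)) = (size (z G)).-1)%N.
      by rewrite ej -!subn1 subnAC subKn.
    by rewrite ej !lead_coefE mulrC subrr.
  have ltj : (size (z P) <= j)%N.
    by rewrite -(prednK sP0) ltn_neqAle eq_sym nej.
  rewrite [(z P)`_j]nth_default // [(z G)`_ _]nth_default ?mulr0 ?subrr //.
  by rewrite leq_subRL ?(leq_trans (leq_subr _ _)) // subnK.
exists k.+1, (Q + (g ^+ k)%:P * Q0), S; split => //.
have -> : (g ^+ k.+1)%:P * P =
    (g ^+ k)%:P * (g%:P * P - Q0 * G) + (g ^+ k)%:P * Q0 * G.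
  by rewrite exprS polyCM mulrBr -!mulrA [g%:P * (_ * _)]mulrCA subrK.
by rewrite mulrDl addrAC [LHS]zD e [RHS]zD.
Qed.

(** If [a 'X] is transcendental over the image of [R], it suffices to keep the leading coefficient
    of [d] nonzero and to choose a value where [d] does not vanish. If it is algebraic, a relation
    [M] of least degree, and a combination of [d] and [M] that is a nonzero constant in [K[X]],
    reduce the claim to two coefficients in [R]. *)
Lemma specializes_poly_point d : a d != 0 ->
  exists (F : finFieldType) (b : {rmorphism {poly R} -> F}),
    (forall r, a r = 0 -> b r = 0) /\ b d != 0.
Proof.
move=> ad.
have lift (F : finFieldType) (b0 : {rmorphism R -> F}) (y : F) :
    exists b : {rmorphism {poly R} -> F}, forall P, b P = (map_poly b0 P).[y].
  have cb : commr_rmorph b0 y by move=> ?; apply: mulrC.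
  by exists (horner_morph cb) => P.
have [[M [aM zM]]|noM] :=
  pselect (exists M, a M = 0 /\ z M != 0); last first.
  have zd0 : z d != 0 by apply: contraNneq ad => zd; rewrite aE zd horner0.
  have [|F [b0 [b0a b0d]]] := specR (a := a0) (d := d`_(size (z d)).-1).
    by rewrite -zE -lead_coefE lead_coef_eq0.
  (* At a root of [E] the image of [d] is invertible; the factor ['X] keeps [E] nonconstant even
     when [d] is constant. *)
  pose E := 'X * map_poly b0 d - 1.
  have bd0 : map_poly b0 d != 0.
    by apply: contraNneq b0d => bd; rewrite -coef_map bd coef0.
  have [|F' [i [y]]] := @finField_ext_root F E.
    rewrite /E size_polyDl size_mul ?polyX_eq0 // size_polyX ?size_polyN ?size_poly1.
      by rewrite addSn /= addSn add0n ltnS size_poly_gt0.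
    by rewrite addSn /= ltnS size_poly_gt0.
  rewrite /root /E rmorphB rmorph1 rmorphM /= map_polyX hornerD hornerN hornerM.
  rewrite hornerC hornerX subr_eq0 => /eqP ey.
  have [b bE] := lift F' (i \o b0) y.
  exists F', b; split=> [P aP|]; last first.
    apply/eqP => bd; move: ey; rewrite -map_poly_comp -bE bd mulr0.
    by move/eqP; rewrite eq_sym oner_eq0.
  have zP : z P = 0 by apply: contrapT => /eqP zP; apply: noM; exists P.
  rewrite bE; have -> : map_poly (i \o b0) P = 0; last by rewrite horner0.
  apply/polyP => j; rewrite coef_map /= b0a ?rmorph0 ?coef0 //.
  by rewrite -coef_map -/(z P) zP coef0.
have {M aM zM} [M [aM zM minM]] : exists M, [/\ a M = 0, z M != 0 &
    forall P, a P = 0 -> (size (z P) < size (z M))%N -> z P = 0].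
  have [n] := ubnP (size (z M)); elim: n M aM zM => // n IH M aM zM.
  rewrite ltnS => sM.
  have [[P [aP [zP lt]]]|no] :=
    pselect (exists P, a P = 0 /\ (z P != 0 /\ (size (z P) < size (z M))%N)).
    by apply: (IH P) => //; apply: leq_trans sM.
  exists M; split=> // P aP lt; apply: contrapT => /eqP zP; apply: no.
  by exists P.
set m := M`_(size (z M)).-1.
have am0 : a0 m != 0 by rewrite -zE -lead_coefE lead_coef_eq0.
(* As in a Bezout identity, a combination [G] of least degree is taken; it will turn out to be
   constant in [K[X]]. *)
pose cG G := (exists U V, z G = z (U * d + V * M)) /\ a G != 0.
have [G [[[U [V zG]] aG] minG]] : exists G, cG G /\
    forall P, cG P -> (size (z G) <= size (z P))%N.
  have : cG d by split=> //; exists 1, 0; rewrite mul1r mul0r addr0.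
  have [n] := ubnP (size (z d)); move: {1 2}d; elim: n => // n IH G.
  rewrite ltnS => sG cGG.
  have [[P [cP lt]]|no] :=
    pselect (exists P, cG P /\ (size (z P) < size (z G))%N).
    by apply: (IH P) => //; apply: leq_trans sG.
  exists G; split=> // P cP; rewrite leqNgt; apply/negP => lt; apply: no.
  by exists P.
have zG0 : z G != 0 by apply: contraNneq aG => zG0; rewrite aE zG0 horner0.
have ltGM : (size (z G) < size (z M))%N.
  have [k [Q [S [e sS]]]] := pseudo_div_along G zM.
  rewrite -/m in e.
  apply: leq_ltn_trans sS; apply: minG; split; last first.
    rewrite -[S](addKr (Q * M)) rmorphD rmorphN !rmorphM aM mulr0 oppr0 add0r.
    by rewrite -(az e) rmorphM mulf_neq0 // -[a _]/(a0 _) rmorphXn expf_neq0.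
  exists ((m ^+ k)%:P * U), ((m ^+ k)%:P * V - Q).
  rewrite -[S](addKr (Q * M)) zD -e -zD; set c := (_ ^+ _)%:P.
  have -> : c * U * d + (c * V - Q) * M = c * (U * d + V * M) - Q * M.
    by rewrite mulrDr mulrBl !mulrA addrA.
  by rewrite addrC zB [z (_ * G)]zMu zG -zMu -zB.
(* By the two minimalities [z S = 0], so in [K[X]] the product of [Q] and [G] is [M] times a nonzero
   constant, and [a Q = 0]. A nonconstant [G] would make [Q] a relation of smaller degree than
   [M]. *)
have [k [Q [S [e sS]]]] := pseudo_div_along M zG0.
set g := G`_ _ in e.
have ag0 : a0 g != 0 by rewrite -zE -lead_coefE lead_coef_eq0.
have aS : a S = 0.
  apply/eqP/negP => /negP aS; have : cG S; last first.
    by move/minG; rewrite leqNgt sS.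
  split=> //; exists (- Q * U), ((g ^+ k)%:P - Q * V).
  rewrite -[S](addKr (Q * G)) zD -e -zD; set c := (_ ^+ _)%:P.
  have -> : - Q * U * d + (c - Q * V) * M = c * M - Q * (U * d + V * M).
    by rewrite mulrDr mulrBl !mulNr opprD !mulrA addrCA.
  by rewrite addrC zB [z (_ * G)]zMu zG -zMu -zB.
have zS : z S = 0 by apply: minM => //; apply: ltn_trans ltGM.
have aQ : a Q = 0.
  have := az e; rewrite rmorphM aM mulr0 rmorphD rmorphM aS addr0 => /esym/eqP.
  by rewrite mulf_eq0 (negPf aG) orbF => /eqP.
have sG1 : size (z G) = 1%N.
  apply/eqP; rewrite eqn_leq size_poly_gt0 zG0 andbT leqNgt; apply/negP => sG.
  have c0 : a0 (g ^+ k) != 0 by rewrite rmorphXn expf_neq0.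
  have := e; rewrite zMu zD zS addr0 zMu zC => e'.
  have zQ0 : z Q != 0.
    apply/eqP => zQ; move: e'; rewrite zQ mul0r => /eqP.
    by rewrite mulf_eq0 polyC_eq0 (negPf c0) (negPf zM).
  have : (size (z Q) < size (z M))%N.
    have := congr1 (fun p : {poly K} => size p) e'.
    rewrite size_Cmul // size_mul // => ->.
    by case: (size (z G)) sG => [|[|s]] // _; rewrite !addnS ltnS leq_addr.
  by move/(minM _ aQ)/eqP; rewrite (negPf zQ0).
(* With [m] nonzero, the image of [M] has a root, and every relation is a multiple of [M] up to a
   power of [m]. With the constant term of [G] nonzero, [d] cannot vanish at that root. *)
have [|F [b0 [b0a b0d]]] := specR (a := a0) (d := m * G`_0).
  rewrite rmorphM mulf_neq0 //; move: ag0; rewrite /g sG1 //.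
move: b0d; rewrite rmorphM mulf_eq0 negb_or => /andP[b0m b0G].
have b0z P P' : z P = z P' -> map_poly b0 P = map_poly b0 P'.
  move=> /polyP eP; apply/polyP => j; rewrite !coef_map /=.
  apply/eqP; rewrite -subr_eq0 -rmorphB; apply/eqP/b0a; rewrite rmorphB.
  by have := eP j; rewrite !coef_map /= => ->; rewrite subrr.
have sM : (1 < size (z M))%N by rewrite -sG1.
have [|F' [i [y]]] := @finField_ext_root F (map_poly b0 M).
  apply: (leq_trans sM); rewrite leqNgt; apply/negP => h.
  move: b0m; rewrite /m -coef_map nth_default ?eqxx //.
  by rewrite -ltnS (ltn_predK sM).
rewrite -map_poly_comp => /rootP yM.
have [b bE] := lift F' (i \o b0) y.
rewrite -bE in yM.
have bz P P' : z P = z P' -> b P = b P'.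
  by rewrite !bE !map_poly_comp => /b0z ->.
have bC c : b c%:P = i (b0 c) by rewrite bE map_polyC hornerC.
exists F', b; split=> [P aP|].
  have [k' [Q' [S' [e' sS']]]] := pseudo_div_along P zM.
  have aS' : a S' = 0.
    have := az e'; rewrite rmorphM aP mulr0 rmorphD rmorphM aM mulr0 add0r.
    by move=> <-.
  have bS' : b S' = 0.
    by rewrite -(rmorph0 b); apply: bz; rewrite (minM _ aS') // /z rmorph0.
  have := bz _ _ e'; rewrite rmorphM rmorphD rmorphM yM mulr0 bS' addr0 -/m.
  move/eqP; rewrite mulf_eq0 bC fmorph_eq0 rmorphXn expf_eq0 (negPf b0m) andbF /=.
  by move/eqP.
apply/eqP => bd; move/bz: zG; rewrite rmorphD !rmorphM bd yM !mulr0 addr0.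
have -> : b G = i (b0 G`_0).
  rewrite -bC; apply: bz; apply/polyP => j; rewrite zC coefC zE.
  by case: j => [//|j]; rewrite -zE nth_default ?sG1.
by move/eqP; rewrite fmorph_eq0 (negPf b0G).
Qed.
End Poly.

Lemma specializes_poly (R : comNzRingType) :
  specializes R -> specializes {poly R}.
Proof. by move=> sR a d; apply: specializes_poly_point. Qed.

(* [R] is an iterated polynomial ring over [int], one variable for each element
   of [s]. *)
Lemma specialization (s : seq K) :
  exists (R : comNzRingType) (a : {rmorphism R -> K}) (F : finFieldType)
    (b : {rmorphism R -> F}),
    (forall r, a r = 0 -> b r = 0) /\ forall x, x \in s -> exists r, a r = x.
Proof.
suff [R [sR [a sa]]] : exists R : comNzRingType, specializes R /\
    exists a : {rmorphism R -> K}, forall x, x \in s -> exists r, a r = x.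
  have [|F [b [ba _]]] := sR a 1; first by rewrite rmorph1 oner_neq0.
  by exists R, a, F, b.
elim: s => [|x s [R [sR [a sa]]]].
  exists int; split; first exact: specializes_int.
  by exists (intmul 1 : {rmorphism int -> K}).
exists {poly R}; split; first exact: specializes_poly.
have ca : commr_rmorph a x by move=> ?; apply: mulrC.
exists (horner_morph ca) => y; rewrite inE => /predU1P[->|/sa[r <-]].
  by exists 'X; rewrite /= horner_morphX.
by exists r%:P; rewrite /= horner_morphC.
Qed.
End Specialization.

(** * Ideals and local generators of primes *)

Section IdealTheory.
Variable R : comNzRingType.
Implicit Types (I J P Q G : set R) (r s x y : R).

Lemma ideal0 I : is_ideal I -> I 0. Proof. by case. Qed.

Lemma idealD I x y : is_ideal I -> I x -> I y -> I (x + y).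
Proof. by case=> _ ID _; apply: ID. Qed.

Lemma ideal_mull I r x : is_ideal I -> I x -> I (r * x).
Proof. by case=> _ _ IM; apply: IM. Qed.

Lemma ideal_mulr I r x : is_ideal I -> I x -> I (x * r).
Proof. by rewrite mulrC; apply: ideal_mull. Qed.

Lemma idealN I x : is_ideal I -> I x -> I (- x).
Proof. by rewrite -mulN1r; apply: ideal_mull. Qed.

Lemma idealB I x y : is_ideal I -> I x -> I y -> I (x - y).
Proof. by move=> iI Ix Iy; apply: idealD => //; apply: idealN. Qed.

Lemma ideal_sum I (T : Type) (s : seq T) (D : pred T) (F : T -> R) :
  is_ideal I -> (forall i, D i -> I (F i)) -> I (\sum_(i <- s | D i) F i).
Proof.
move=> iI IF; elim/big_rec: _ => [|i x Di Ix]; first exact: ideal0.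
by apply: idealD => //; apply: IF.
Qed.

Lemma is_ideal_gen G : is_ideal (ideal_gen G).
Proof.
split=> [A [iA _]|x y Ix Iy A iGA|r x Ix A iGA]; first exact: ideal0.
  by apply: idealD (Ix A iGA) (Iy A iGA); case: iGA.
by apply: ideal_mull (Ix A iGA); case: iGA.
Qed.

Lemma sub_ideal_gen G : G `<=` ideal_gen G.
Proof. exact: sub_gen_smallest. Qed.

Lemma ideal_gen_min G I : is_ideal I -> G `<=` I -> ideal_gen G `<=` I.
Proof. exact: smallest_sub. Qed.

Lemma ideal_gen_sub G G' : G `<=` G' -> ideal_gen G `<=` ideal_gen G'.
Proof.
move=> sGG'; apply: ideal_gen_min; first exact: is_ideal_gen.
exact: subset_trans sGG' (@sub_ideal_gen G').
Qed.

Lemma ideal_gen_range (T : finType) (g : T -> R) x :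
  ideal_gen (range g) x -> exists c : T -> R, x = \sum_i c i * g i.
Proof.
apply: (@ideal_gen_min _ [set x | exists c : T -> R, x = \sum_i c i * g i]).
  split=> [|_ _ [c ->] [d ->]|r _ [c ->]].
  - by exists (fun=> 0); rewrite big1 // => i _; rewrite mul0r.
  - exists (fun i => c i + d i); rewrite -big_split.
    by apply: eq_bigr => i _; rewrite mulrDl.
  - exists (fun i => r * c i); rewrite mulr_sumr.
    by apply: eq_bigr => i _; rewrite mulrA.
move=> _ [i _ <-]; exists (fun j => (j == i)%:R).
rewrite (bigD1 i) //= eqxx mul1r big1 ?addr0 // => j /negPf ->.
by rewrite mul0r.
Qed.

Lemma prime_ideal P : is_prime P -> is_ideal P. Proof. by case. Qed.

Lemma prime_mulN P x y : is_prime P -> ~ P x -> ~ P y -> ~ P (x * y).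
Proof. by case=> _ _ PM Px Py /PM[]. Qed.

Lemma prime_expr P x k : is_prime P -> P (x ^+ k) -> P x.
Proof.
case=> _ P1 PM; elim: k => [|k IH]; first by rewrite expr0 => /P1.
by rewrite exprS => /PM[].
Qed.

Lemma prime_exprN P x k : is_prime P -> ~ P x -> ~ P (x ^+ k).
Proof. by move=> pP Px /prime_expr; apply: contra_not Px; apply. Qed.

(** For [P] prime, this is the preimage in [R] of the extension of [I] to the localization at
    [P]. *)
Definition saturation P I : set R := [set x | exists2 s, ~ P s & I (s * x)].

Lemma is_ideal_saturation P I :
  is_prime P -> is_ideal I -> is_ideal (saturation P I).
Proof.
move=> pP iI; have [_ P1 _] := pP.
split=> [|x y [s Ps Is] [t Pt It]|r x [s Ps Is]].
- by exists 1 => //; rewrite mulr0; apply: ideal0.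
- exists (s * t); first exact: prime_mulN.
  rewrite mulrDr -!mulrA; apply: idealD => //; last exact: ideal_mull.
  by rewrite mulrCA; apply: ideal_mull.
- by exists s => //; rewrite mulrCA; apply: ideal_mull.
Qed.

Lemma sub_saturation P I : is_prime P -> I `<=` saturation P I.
Proof. by case=> _ P1 _ x Ix; exists 1 => //; rewrite mul1r. Qed.

Lemma saturationK P I s x : is_prime P -> ~ P s ->
  saturation P I (s * x) -> saturation P I x.
Proof.
by move=> pP Ps [t Pt It]; exists (t * s); [apply: prime_mulN|rewrite -mulrA].
Qed.

(* A weak form of regularity of the local rings of [R]: the maximal ideal of
   the localization at [P] has as many generators as some chain below [P] is
   long. *)
Definition locally_generated_by_height : Prop :=
  forall P, is_prime P -> exists (k : nat) (y : 'I_k -> R) (c : nat -> set R),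
    [/\ prime_chain c k P, forall i, P (y i)
      & P `<=` saturation P (ideal_gen (range y))].

End IdealTheory.

Section Preimage.
Variables (R S : comNzRingType) (f : {rmorphism R -> S}).

Lemma preimage_ideal (I : set S) : is_ideal I -> is_ideal (f @^-1` I).
Proof.
move=> iI; split=> [|x y Ix Iy|r x Ix] /=; first by rewrite rmorph0; apply: ideal0.
  by rewrite /preimage /= rmorphD; apply: idealD.
by rewrite /preimage /= rmorphM; apply: ideal_mull.
Qed.

Lemma preimage_prime (P : set S) : is_prime P -> is_prime (f @^-1` P).
Proof.
case=> iP P1 PM; split; first exact: preimage_ideal.
  by rewrite /preimage /= rmorph1.
by move=> x y; rewrite /preimage /= rmorphM => /PM.
Qed.
End Preimage.

Lemma locally_generated_iso (R S : comNzRingType) (f : {rmorphism R -> S})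
    (g : {rmorphism S -> R}) : cancel f g -> cancel g f ->
  locally_generated_by_height R -> locally_generated_by_height S.
Proof.
move=> fK gK lR P pP.
have [k [y [c [[cp cs ck] Py gen]]]] := lR _ (preimage_prime f pP).
exists k, (f \o y), (fun i => g @^-1` c i); split=> //.
- split=> [i lei|i lti|]; first exact/preimage_prime/cp.
    split=> [x|sub]; first by case: (cs i lti) => + _; apply.
    case: (cs i lti) => _; apply => x cx.
    by have := sub (f x); rewrite /preimage /= fK; apply.
  by rewrite ck; apply/seteqP; split=> x; rewrite /preimage /= gK.
- move=> x Px; have [|s Ps ys] := gen (g x); first by rewrite /preimage /= gK.
  exists (f s); first by move=> Pfs; apply: Ps.
  rewrite -[x]gK -rmorphM.
  apply: (@ideal_gen_min _ (range y) (f @^-1` ideal_gen (range (f \o y)))) ys.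
    exact/preimage_ideal/is_ideal_gen.
  by move=> _ [i _ <-]; apply: sub_ideal_gen; exists i.
Qed.

(** * Primes of a polynomial ring in one variable *)

Section PolyIdeal.
Variable R : idomainType.
Implicit Types (A : set R) (P : set {poly R}).

Definition coef_ideal A : set {poly R} := [set F | forall i, A F`_i].

(** Gauss's argument: if [i] and [j] are the least indices of coefficients of [F] and [G] outside
    [A], the coefficient of [F * G] at [i + j] is the product of these two modulo [A]. *)
Lemma coef_ideal_prime A : is_prime A -> is_prime (coef_ideal A).
Proof.
move=> pA; have [iA A1 AM] := pA; split; last first.
- move=> F G FG; apply: contrapT => /not_orP[/existsNP nF /existsNP nG].
  have exb (H : {poly R}) : (exists i, ~ A H`_i) -> exists i, ~~ `[< A H`_i >].
    by case=> i nA; exists i; apply/asboolP.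
  case: (ex_minnP (exb _ nF)) => i /asboolP nAi mi.
  case: (ex_minnP (exb _ nG)) => j /asboolP nAj mj.
  have lF a : (a < i)%N -> A F`_a.
    move=> lt; apply: contrapT => nA; have := mi a; rewrite leqNgt lt.
    by move=> /(_ _)/negP; case=> //; apply/asboolP.
  have lG b : (b < j)%N -> A G`_b.
    move=> lt; apply: contrapT => nA; have := mj b; rewrite leqNgt lt.
    by move=> /(_ _)/negP; case=> //; apply/asboolP.
  have := FG (i + j)%N; rewrite coefM.
  have lti : (i < (i + j).+1)%N by rewrite ltnS leq_addr.
  rewrite (bigD1 (Ordinal lti)) //= addKn => As.
  apply: (prime_mulN pA nAi nAj).
  rewrite -[_ * _](addrK
    (\sum_(k < (i + j).+1 | k != Ordinal lti) F`_k * G`_(i + j - k))).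
  apply: idealB => //; apply: ideal_sum => // k nk.
  have [ltk|gtk|ek] := ltngtP k i; last by case/eqP: nk; apply/val_inj.
    by apply: ideal_mulr => //; apply: lF.
  apply: ideal_mull => //; apply: lG.
  by rewrite ltn_subLR ?ltn_add2r // -ltnS.
- by move=> /(_ 0%N); rewrite coef1.
- split=> [i|F G AF AG i|F G AG i]; first by rewrite coef0; apply: ideal0.
    by rewrite coefD; apply: idealD.
  by rewrite coefM; apply: ideal_sum => // j _; apply: ideal_mull.
Qed.

(** Let [Q] be the contraction of [P] to [R]. Either [P] is the extension of [Q], with the same
    generators and an extended chain, or [P] lies strictly above it. In that case the chain grows by
    [P], and the generators by an element [g] of least degree in [P] outside the extension. *)
Lemma locally_generated_poly :
  locally_generated_by_height R -> locally_generated_by_height {poly R}.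
Proof.
move=> lR P pP; have iP := prime_ideal pP.
set Q := (polyC : {rmorphism R -> {poly R}}) @^-1` P.
have pQ : is_prime Q by apply: preimage_prime.
have [k [y [c [[cp cs ck] Qy gen]]]] := lR _ pQ.
pose Y := range (fun i => (y i)%:P).
have QY (J : set {poly R}) : is_ideal J -> Y `<=` J ->
    coef_ideal Q `<=` saturation P J.
  move=> iJ YJ F QF; rewrite -[F]coefK poly_def.
  apply: ideal_sum => [|i _]; first exact: is_ideal_saturation.
  rewrite -mul_polyC; apply: ideal_mulr; first exact: is_ideal_saturation.
  have [s Qs gs] := gen _ (QF i); exists s%:P => //.
  rewrite -polyCM.
  apply: (@ideal_gen_min _ (range y) ((polyC : {rmorphism R -> {poly R}}) @^-1` J)) gs.
    exact: preimage_ideal.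
  by move=> _ [j _ <-]; apply: YJ; exists j.
have chainX i : (i < k)%N -> coef_ideal (c i) `<` coef_ideal (c i.+1).
  move=> lti; have [sub nsub] := cs i lti; split=> [F cF j|sub']; first exact: sub.
  apply: nsub => x cx; have := sub' x%:P; rewrite /coef_ideal /= => /(_ _ 0%N).
  rewrite coefC; apply=> -[|j]; rewrite coefC //=.
  by apply: ideal0; apply: prime_ideal; apply: cp.
have QXP : coef_ideal Q `<=` P.
  move=> F QF; rewrite -[F]coefK poly_def; apply: ideal_sum => // i _.
  by rewrite -mul_polyC; apply: ideal_mulr => //; apply: QF.
have [PQ|nPQ] := pselect (P `<=` coef_ideal Q).
  exists k, (fun i => (y i)%:P), (fun i => coef_ideal (c i)); split=> //.
    split=> [i lei| |]; [exact/coef_ideal_prime/cp|exact: chainX|].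
    by rewrite ck; apply/seteqP.
  apply: (subset_trans PQ); apply: QY; first exact: is_ideal_gen.
  exact: sub_ideal_gen.
have [g [Pg nQg ming]] : exists g, [/\ P g, ~ coef_ideal Q g &
    forall F, P F -> (size F < size g)%N -> coef_ideal Q F].
  move/existsNP: nPQ => [g /not_implyP[Pg nQg]].
  have [n] := ubnP (size g); elim: n g Pg nQg => // n IH g Pg nQg.
  rewrite ltnS => sg.
  have [[F [PF [nF lt]]]|no] :=
    pselect (exists F, P F /\ (~ coef_ideal Q F /\ (size F < size g)%N)).
    by apply: (IH F) => //; apply: leq_trans sg.
  exists g; split=> // F PF lt; apply: contrapT => nF; apply: no.
  by exists F.
have g0 : g != 0.
  apply/eqP => e; apply: nQg; rewrite e; apply: ideal0.
  exact/prime_ideal/coef_ideal_prime.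
have sg0 : (0 < size g)%N by rewrite size_poly_gt0.
(* Otherwise removing the leading term of [g] leaves an element of [P] of smaller size, hence of
   [coef_ideal Q], and then [g] belongs there too. *)
have nQl : ~ P (lead_coef g)%:P.
  move=> Pl; apply: nQg => i.
  have Pt : P (g - (lead_coef g)%:P * 'X^((size g).-1)).
    by apply: idealB => //; apply: ideal_mulr.
  have lts : (size (g - (lead_coef g)%:P * 'X^((size g).-1) : {poly R})%R < size g)%N.
    rewrite -[X in (_ < X)%N](prednK sg0) ltnS; apply/leq_sizeP => j lej.
    rewrite coefB coefCM coefXn.
    have [->|nj] := eqVneq j (size g).-1; first by rewrite mulr1 lead_coefE subrr.
    rewrite mulr0 subr0 nth_default // -(prednK sg0).
    by rewrite ltn_neqAle eq_sym nj lej.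
  have := ming _ Pt lts i; rewrite coefB coefCM coefXn.
  have [->|_] := eqVneq i (size g).-1; first by rewrite -lead_coefE.
  by rewrite mulr0 subr0.
pose y' (i : 'I_k.+1) := oapp (fun j => (y j)%:P) g (unlift ord_max i).
pose c' i := if (i <= k)%N then coef_ideal (c i) else P.
exists k.+1, y', c'; split.
- split=> [i _|i|]; rewrite /c'; last by rewrite ltnn.
    by case: ifP => // lei; apply/coef_ideal_prime/cp.
  move=> ltiS; have [->|nik] := eqVneq i k.
    by rewrite leqnn ltnn ck; split=> // sub; apply: nQg; apply: sub.
  have lti : (i < k)%N by rewrite ltn_neqAle nik -ltnS.
  by rewrite lti (ltnW lti); apply: chainX.
- by move=> i; rewrite /y'; case: unliftP => [j _|_] //=; apply: Qy.
- move=> F PF; pose J := ideal_gen (range y').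
  have iJ : is_ideal J by apply: is_ideal_gen.
  have Jg : J g by apply: sub_ideal_gen; exists ord_max => //; rewrite /y' unlift_none.
  have YJ : Y `<=` J.
    move=> _ [i _ <-]; apply: sub_ideal_gen; exists (lift ord_max i) => //.
    by rewrite /y' liftK.
  have e := Pdiv.Idomain.divp_eq F g.
  have PS : P (F %% g)%R.
    rewrite -[(F %% g)%R](addKr ((F %/ g)%R * g)) -e addrC -mul_polyC.
    by apply: idealB => //; apply: ideal_mull.
  (* The multiplier of pseudo-division is outside [P], so it may be cancelled in the saturation; the
     remainder is in [coef_ideal Q] by the choice of [g]. *)
  apply: (@saturationK _ _ _ ((lead_coef g ^+ scalp F g)%:P)) => //.
    by rewrite rmorphXn; apply: prime_exprN.
  rewrite mul_polyC e; apply: idealD; first exact: is_ideal_saturation.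
    by apply: ideal_mull; [exact: is_ideal_saturation|exact: sub_saturation].
  by apply: QY => //; apply: ming => //; rewrite ltn_modp.
Qed.
End PolyIdeal.

(** * Splitting off the last variable *)

Section MpolyIso.
Variables (n : nat) (R : comNzRingType).

Lemma muniX (i : 'I_n) :
  muni ('X_(widen_ord (leqnSn n) i) : {mpoly R[n.+1]}) = ('X_i)%:P.
Proof.
rewrite muniE msuppX big_seq1 mcoeffX eqxx scale1r mnm1E.
have -> : (widen_ord (leqnSn n) i == ord_max) = false.
  by apply/negbTE; rewrite -val_eqE /= ltn_eqF.
rewrite expr0 alg_polyC; congr ('X_[_])%:P; apply/mnmP => j.
by rewrite mnmE !mnm1E -!val_eqE.
Qed.

Lemma muniX_max : muni ('X_ord_max : {mpoly R[n.+1]}) = 'X.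
Proof.
rewrite muniE msuppX big_seq1 mcoeffX eqxx scale1r mnm1E eqxx expr1.
suff -> : [multinom U_(ord_max)%MM (widen_ord (leqnSn n) i) | i < n] = 0%MM.
  by rewrite mpolyX0 scale1r.
apply/mnmP => j; rewrite mnmE mnm1E mnm0E -val_eqE /= eq_sym.
by rewrite ltn_eqF.
Qed.

Lemma muni_widen (p : {mpoly R[n]}) : muni (mwiden p) = p%:P.
Proof.
elim/mpolyind: p => [|c m p _ _ IH]; first by rewrite mwiden0 muni0.
rewrite mwidenD muniD IH rmorphD /=; congr (_ + _).
rewrite mwidenZ muniZ -!mul_mpolyC rmorphM /= -mul_polyC; congr (_ * _).
rewrite mpolyXE_id !rmorph_prod /=; apply: eq_bigr => i _.
rewrite !rmorphXn /= mwidenX mnmwiden1 muniX //.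
Qed.

Let cX : commr_rmorph (@mwiden n R) 'X_ord_max.
Proof. by move=> ?; apply: mulrC. Qed.

Definition muni_inv : {rmorphism {poly {mpoly R[n]}} -> {mpoly R[n.+1]}} :=
  horner_morph cX.

Lemma muni_invK : cancel muni_inv (@muni n R).
Proof.
elim/poly_ind => [|p c IH]; first by rewrite !rmorph0.
rewrite !(rmorphD, rmorphM) /= IH /muni_inv /= horner_morphX horner_morphC.
by rewrite muniX_max muni_widen.
Qed.

Lemma muniK : cancel (@muni n R) muni_inv.
Proof.
elim/mpolyind => [|c m p _ _ IH]; first by rewrite muni0 rmorph0.
rewrite muniD [LHS]rmorphD [X in _ + X]IH; apply: (congr1 (fun q => q + p)).
rewrite muniZ -mul_polyC [LHS]rmorphM.
have -> : muni_inv (c%:MP%:P) = c%:MP by rewrite -[RHS](mwidenC n c); apply: horner_morphC.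
rewrite -[RHS]mul_mpolyC; apply: (congr1 (fun q => c%:MP * q)).
rewrite mpolyXE_id !rmorph_prod; apply: eq_bigr => i _.
rewrite !rmorphXn; apply: (congr1 (fun q => q ^+ m i)).
have [j ->|->] := unliftP ord_max i; last first.
  by apply: etrans (congr1 muni_inv muniX_max) _; apply: horner_morphX.
have -> : lift ord_max j = widen_ord (leqnSn n) j.
  by apply/val_inj => /=; rewrite /bump leqNgt ltn_ord.
apply: etrans (congr1 muni_inv (muniX j)) _.
by rewrite -mnmwiden1 -mwidenX; apply: horner_morphC.
Qed.
End MpolyIso.

Lemma locally_generated_mpoly (K : fieldType) n :
  locally_generated_by_height {mpoly K[n]}.
Proof.
elim: n => [|n IH]; last first.
  exact: locally_generated_iso (@muni_invK n K) (@muniK n K) (locally_generated_poly IH).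
(* Without variables the ring is a field: a nonzero element of [P] would be a unit, so [P] is zero
   and needs no generator. *)
move=> P pP; have [iP P1 _] := pP.
exists 0%N, (fun=> 0), (fun=> P); split=> [|[]//|F PF]; first by split.
have [F0|F0] := eqVneq F 0.
  rewrite F0; exists 1; [exact: P1|rewrite mulr0]; apply: ideal0; exact: is_ideal_gen.
case: P1; rewrite (_ : 1 = ((F@_0%MM)^-1)%:MP * F); first exact: ideal_mull.
rewrite [X in _ * X]nvar0_mpolyC -mpolyCM mulVf ?mpolyC1 //.
by apply: contraNneq F0 => e; rewrite [F]nvar0_mpolyC e.
Qed.

(** * Dickson's lemma and division *)

(** Each next index is one where [f] is least on the tail after the previous index. *)
Lemma nondecreasing_subseq (f : nat -> nat) :
  exists p : nat -> nat, {homo p : i j / (i < j)%N} /\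
    {homo f \o p : i j / (i <= j)%N}.
Proof.
have minf N : exists i, (N <= i)%N /\ forall j, (N <= j)%N -> (f i <= f j)%N.
  have exf : exists v, `[< exists2 i, (N <= i)%N & f i = v >].
    by exists (f N); apply/asboolP; exists N.
  case: (ex_minnP exf) => v /asboolP[i leNi <-] minv; exists i; split=> // j leNj.
  by apply: minv; apply/asboolP; exists j.
have [g gP] := choice minf.
pose p := fix p k := if k is k'.+1 then g (p k').+1 else g 0%N.
have pS k : (p k < p k.+1)%N by have [] := gP (p k).+1.
exists p; split; first by apply: homo_ltn => //; exact: ltn_trans.
apply: homo_leq => [//|j i k|i]; first exact: leq_trans.
rewrite /comp; have [N e] : exists N, p i = g N.
  by case: i => [|i]; [exists 0%N|exists (p i).+1].
have [lei mini] := gP N; rewrite {1}e; apply: mini.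
by apply: leq_trans (ltnW (pS i)); rewrite e.
Qed.

(** Coordinates are treated one at a time: a further subsequence keeps the monotonicity already
    obtained. *)
Lemma dickson n (s : nat -> 'X_{1..n}) :
  exists i j, (i < j)%N /\ (s i <= s j)%MM.
Proof.
suff [p [pi ps]] : exists p : nat -> nat, {homo p : i j / (i < j)%N} /\
    forall c, c \in enum 'I_n -> {homo (fun i => s (p i) c) : i j / (i <= j)%N}.
  exists (p 0%N), (p 1%N); split; first exact: pi.
  by apply/mnm_lepP => c; apply: ps; rewrite ?mem_enum.
elim: (enum 'I_n) => [|c l [p [pi ps]]].
  by exists id; split=> // c; rewrite in_nil.
have [q [qi qs]] := nondecreasing_subseq (fun i => s (p i) c).
exists (p \o q); split=> [i j lt|d]; first by apply/pi/qi.
rewrite inE => /predU1P[->|dl] i j lij; first exact: qs.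
apply: ps => //; move: lij; rewrite leq_eqVlt => /predU1P[->//|lt].
by apply/ltnW/qi.
Qed.

(** Otherwise elements of [M] could be chosen forever, each divisible by none of the earlier ones,
    against [dickson]. *)
Lemma dickson_basis n (M : set 'X_{1..n}) : exists s : seq 'X_{1..n},
  (forall m, m \in s -> M m) /\
  forall m, M m -> exists2 m', m' \in s & (m' <= m)%MM.
Proof.
apply: contrapT => no.
have step (s : seq 'X_{1..n}) : exists m, (forall m', m' \in s -> M m') ->
    M m /\ forall m', m' \in s -> ~ (m' <= m)%MM.
  have [sM|nsM] := pselect (forall m', m' \in s -> M m'); last by exists 0%MM.
  apply: contrapT => nom; apply: no; exists s; split=> // m Mm.
  apply: contrapT => ndiv; apply: nom; exists m => _; split=> // m' m's le'.
  by apply: ndiv; exists m'.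
have [g gP] := choice step.
pose L := fix L k := if k is k'.+1 then rcons (L k') (g (L k')) else [::].
have LM k m : m \in L k -> M m.
  elim: k m => [|k IH] m //=; rewrite mem_rcons inE => /predU1P[->|/IH//].
  by case: (gP (L k)).
have Lmem i j : (i < j)%N -> g (L i) \in L j.
  elim: j => // j IH; rewrite ltnS leq_eqVlt /= mem_rcons inE.
  by move=> /predU1P[->|/IH ->]; rewrite ?eqxx ?orbT.
have [i [j [ltij dvd]]] := dickson (g \o L).
by have [_ /(_ _ (Lmem _ _ ltij))] := gP (L j) (@LM j).
Qed.

(** * Monomial orders, leading monomials and Groebner bases *)

Section MonomialOrder.
Variables (n : nat) (le : rel 'X_{1..n}).
Hypothesis mo : monomial_order le.
Implicit Types m k : 'X_{1..n}.

Lemma mole_refl m : le m m. Proof. by case: mo => [[]]. Qed.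
Lemma mole_trans m2 m1 m3 : le m1 m2 -> le m2 m3 -> le m1 m3.
Proof. by case: mo => [[_ _ tr _]] _ _; apply: tr. Qed.
Lemma mole_anti m1 m2 : le m1 m2 -> le m2 m1 -> m1 = m2.
Proof. by case: mo => [[_ anti _ _]] _ _ h1 h2; apply: anti; rewrite h1. Qed.
Lemma mole_total m1 m2 : le m1 m2 || le m2 m1.
Proof. by case: mo => [[_ _ _ tot]]. Qed.
Lemma moleDr m m1 m2 : le m1 m2 -> le (m1 + m)%MM (m2 + m)%MM.
Proof. by case: mo => _ _; apply. Qed.
Lemma moleD m1 m2 k1 k2 : le m1 k1 -> le m2 k2 -> le (m1 + m2)%MM (k1 + k2)%MM.
Proof.
move=> h1 h2; apply: (@mole_trans (k1 + m2)%MM); first exact: moleDr.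
by rewrite ![(k1 + _)%MM]addmC; apply: moleDr.
Qed.
Lemma mole_dvd m1 m2 : (m1 <= m2)%MM -> le m1 m2.
Proof.
move=> d; rewrite -(submK d) -{1}[m1]add0m; apply: moleDr.
by case: mo => _ + _; apply.
Qed.
Lemma mole_cancelr m m1 m2 : le (m1 + m)%MM (m2 + m)%MM -> le m1 m2.
Proof.
move=> h; case/orP: (mole_total m1 m2) => // h2.
have := mole_anti h (moleDr m h2) => /addIm ->; exact: mole_refl.
Qed.

(** A counterexample starts an infinite strictly decreasing sequence; by [dickson] some term divides
    a later one, hence is below it. *)
Lemma mole_ind (P : 'X_{1..n} -> Prop) :
  (forall m, (forall k, le k m -> k <> m -> P k) -> P m) -> forall m, P m.
Proof.
move=> ind; apply: contrapT => /existsNP[m0 nP0].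
have step (m : 'X_{1..n}) : exists k, ~ P m -> [/\ ~ P k, le k m & k <> m].
  have [Pm|nPm] := pselect (P m); first by exists m.
  apply: contrapT => no; apply: nPm; apply: ind => k lek nek.
  by apply: contrapT => nPk; apply: no; exists k.
have [g gP] := choice step.
pose s i := iter i g m0.
have sN i : ~ P (s i) by elim: i => // i IH; have [] := gP _ IH.
have sle i j : (i <= j)%N -> le (s j) (s i).
  move=> /subnK <-; elim: (j - i)%N => [|d IH]; first exact: mole_refl.
  by rewrite addSn; apply: mole_trans IH; have [] := gP _ (sN (d + i)%N).
have [i [j [ltij /mole_dvd d]]] := dickson s.
have [_ le1 ne1] := gP _ (sN i); apply: ne1; apply: mole_anti => //.
exact: mole_trans d (sle _ _ ltij).
Qed.

Section Monic.
Variable R : comNzRingType.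
Implicit Types f g : {mpoly R[n]}.

Definition monic_at f m := f@_m = 1 /\ forall k, k \in msupp f -> le k m.

Lemma monic_atX m : monic_at 'X_[m] m.
Proof.
split=> [|k]; first by rewrite mcoeffX eqxx.
by rewrite msuppX inE => /eqP ->; exact: mole_refl.
Qed.

Lemma monic_atM f g m k : monic_at f m -> monic_at g k ->
  monic_at (f * g) (m + k)%MM.
Proof.
move=> [f1 fl] [g1 gl]; split; last first.
  move=> l /msuppM_le /allpairsP[[l1 l2] /= [h1 h2 ->]].
  by apply: moleD; [exact: fl|exact: gl].
(* All monomials of [f - 'X_[m]] are strictly below [m], so only ['X_[m] * g] contributes at
   [m + k]. *)
rewrite -[f](subrK 'X_[m]) mulrDl mcoeffD [_ * g]mulrC.
rewrite ['X_[m] * g]mulrC mcoeffMX g1 memN_msupp_eq0 ?add0r //.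
apply/negP => /msuppM_le /allpairsP[[k' m'] /= [kg mf e]].
have m'm : m' != m.
  by apply: contraTneq mf => ->; rewrite mcoeff_msupp mcoeffB f1 mcoeffX eqxx subrr eqxx.
have lem' : le m' m.
  move/msuppB_le: mf; rewrite mem_cat msuppX inE => /orP[/fl //|/eqP ->].
  exact: mole_refl.
case/eqP: m'm; apply: mole_anti => //; apply: (@mole_cancelr k).
by rewrite e addmC; apply: moleD; [exact: mole_refl|exact: gl].
Qed.

Lemma monic_atXn f m q : monic_at f m -> monic_at (f ^+ q) (m *+ q)%MM.
Proof.
move=> fm; elim: q => [|q IH]; last by rewrite exprS mulmS; apply: monic_atM.
by rewrite mulm0n expr0 -mpolyX0; apply: monic_atX.
Qed.
End Monic.

Section Leading.
Variable K : fieldType.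
Implicit Types (f g : {mpoly K[n]}) (D : set {mpoly K[n]}).

Lemma initial_monom_exists f : f != 0 -> exists m, initial_monom le f m.
Proof.
rewrite -msupp_eq0 /initial_monom; case: (msupp f) => // x s _.
elim: s x => [|y s IH] x.
  by exists x; split=> [|k]; rewrite inE // => /eqP ->; exact: mole_refl.
have [m [ms mm]] := IH y.
have [lexm|lemx] := orP (mole_total x m).
  exists m; split=> [|k]; first by rewrite inE ms orbT.
  by rewrite inE => /predU1P[->//|/mm].
exists x; split=> [|k]; first by rewrite mem_head.
rewrite inE => /predU1P[->|/mm h]; first exact: mole_refl.
exact: mole_trans lemx.
Qed.

Definition lead_monoms D : set 'X_{1..n} :=
  [set m | exists2 f, D f & initial_monom le f m].

Definition standard D f := forall m, m \in msupp f -> ~ lead_monoms D m.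

Lemma initial_monic f m : initial_monom le f m ->
  monic_at ((f@_m)^-1 *: f) m.
Proof.
move=> [mf ml]; split=> [|k /msuppZ_le/ml //].
by rewrite mcoeffZ mulVf // -mcoeff_msupp.
Qed.

Lemma monic_initial f m : monic_at f m -> initial_monom le f m.
Proof. by case=> f1 fl; split=> //; rewrite mcoeff_msupp f1 oner_neq0. Qed.

Lemma lead_monic D m : is_ideal D -> lead_monoms D m ->
  exists2 f, D f & monic_at f m.
Proof.
move=> iD [f Df fm]; exists ((f@_m)^-1 *: f); last exact: initial_monic.
by rewrite -mul_mpolyC; apply: ideal_mull.
Qed.

Lemma lead_monoms_dvd D m k : is_ideal D -> lead_monoms D m -> (m <= k)%MM ->
  lead_monoms D k.
Proof.
move=> iD /(lead_monic iD)[f Df fm] d; exists ('X_[k - m] * f).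
  exact: ideal_mull.
by rewrite -{2}(submK d); apply/monic_initial/monic_atM => //; exact: monic_atX.
Qed.

Lemma standard_eq0 D f : D f -> standard D f -> f = 0.
Proof.
move=> Df sf; apply/eqP/negPn/negP => /initial_monom_exists[m fm].
by case: (sf m); [case: fm|exists f].
Qed.

Lemma standardD D f g : standard D f -> standard D g -> standard D (f + g).
Proof. by move=> sf sg m /msuppD_le; rewrite mem_cat => /orP[/sf|/sg]. Qed.

Lemma standardZ D c f : standard D f -> standard D (c *: f).
Proof. by move=> sf m /msuppZ_le/sf. Qed.

Lemma standardX D m : ~ lead_monoms D m -> standard D 'X_[m].
Proof. by move=> Dm k; rewrite msuppX inE => /eqP ->. Qed.

(** Reduction uses monic elements of [B], so it involves no inverse and stays over any subring
    containing the coefficients of [B]. *)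
Definition groebner D (B : seq {mpoly K[n]}) :=
  (forall b, b \in B -> D b) /\
  forall m, lead_monoms D m -> exists b k,
    [/\ b \in B, monic_at b k & (k <= m)%MM].

Lemma groebner_exists D : is_ideal D -> exists B, groebner D B.
Proof.
move=> iD; have [s [sM sdvd]] := dickson_basis (lead_monoms D).
have step m : exists f, m \in s -> D f /\ monic_at f m.
  have [ms|nms] := boolP (m \in s); last by exists 0.
  by have [f Df fm] := lead_monic iD (sM _ ms); exists f.
have [g gP] := choice step.
exists (map g s); split=> [_ /mapP[m ms ->]|m /sdvd[k ks d]].
  by have [] := gP _ ms.
by exists (g k), k; rewrite map_f //; have [] := gP _ ks.
Qed.

Definition liftable (R : comNzRingType) (a : {rmorphism R -> K}) f :=
  exists F : {mpoly R[n]}, map_mpoly a F = f.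

Section Division.
Variables (R : comNzRingType) (a : {rmorphism R -> K}).
Variables (D E : set {mpoly K[n]}) (B : seq {mpoly K[n]}).
Hypotheses (gB : groebner D B) (lB : forall b, b \in B -> liftable a b).
Hypotheses (E0 : E 0) (ED : forall f g, E f -> E g -> E (f + g)).
Hypotheses (EZ : forall r f, E f -> E (a r *: f)).
Hypotheses (EB : forall m b, b \in B -> E ('X_[m] * b)).
Hypotheses (EX : forall m, ~ lead_monoms D m -> E 'X_[m]).

(** The division algorithm as an induction principle: [E] will be the set of polynomials having some
    decomposition with coefficients in [a(R)], and the induction runs along the monomial order. *)
Lemma division_closure f : liftable a f -> E f.
Proof.
have Esum (s : seq 'X_{1..n}) (G : 'X_{1..n} -> R) :
    (forall m, m \in s -> E 'X_[m]) -> E (\sum_(m <- s) a (G m) *: 'X_[m]).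
  elim: s => [|m s IH] sE; first by rewrite big_nil.
  rewrite big_cons; apply: ED; first by apply/EZ/sE/mem_head.
  by apply: IH => k ks; apply: sE; rewrite inE ks orbT.
suff EXm m : E 'X_[m].
  case=> F <-; rewrite [map_mpoly a F]mpolyE.
  under eq_bigr do rewrite mcoeff_map_mpoly.
  exact: Esum.
elim/mole_ind: m => m IH.
have [Dm|nDm] := pselect (lead_monoms D m); last exact: EX.
have [b [k [bB [b1 bl] d]]] := gB.2 _ Dm.
have [F Fb] := lB bB.
(* The sum is minus the shifted tail of [b]: its monomials are strictly below [m], its coefficients
   in [a(R)]. *)
have -> : 'X_[m] = 'X_[m - k] * b +
    \sum_(l <- [seq (m - k + l)%MM | l <- rem k (msupp b)])
      a (- F@_(l - (m - k))) *: 'X_[l].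
  rewrite big_map.
  have -> : \sum_(j <- rem k (msupp b))
      a (- F@_(m - k + j - (m - k))) *: 'X_[m - k + j] =
    - 'X_[m - k] * \sum_(j <- rem k (msupp b)) b@_j *: 'X_[j] :> {mpoly K[n]}.
    rewrite mulr_sumr; apply: eq_bigr => j _.
    rewrite addmC addmK rmorphN -mcoeff_map_mpoly Fb addmC mpolyXD.
    by rewrite scaleNr mulNr -scalerAr.
  have kb : k \in msupp b by rewrite mcoeff_msupp b1 oner_neq0.
  rewrite [X in _ * X + _]mpolyE (perm_big _ (perm_to_rem kb)) big_cons b1 scale1r /=.
  by rewrite mulrDr mulNr addrK -mpolyXD submK.
apply: ED; first exact: EB.
apply: Esum => _ /mapP[l lr ->]; apply: IH.
  rewrite -{2}(submK d) addmC [(_ - _ + k)%MM]addmC; apply: moleDr.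
  by apply: bl; apply: mem_rem lr.
rewrite -{2}(submK d) => /addmI e; move: lr.
by rewrite e mem_rem_uniq ?msupp_uniq // inE eqxx.
Qed.
End Division.
End Leading.
End MonomialOrder.

(** * Prime decomposition of radicals *)

Section Noetherian.
Variables (K : fieldType) (n : nat) (le : rel 'X_{1..n}).
Hypothesis mo : monomial_order le.
Implicit Types I J : set {mpoly K[n]}.

Lemma lead_monoms_sub I J : I `<=` J -> lead_monoms le I `<=` lead_monoms le J.
Proof. by move=> sub m [f If fm]; exists f => //; apply: sub. Qed.

(** Without a new leading monomial, the leading term of any element of [J] could be cancelled by an
    element of [I], and induction on a bound for its monomials would put it in [I]. *)
Lemma lead_monoms_proper I J : is_ideal I -> is_ideal J -> I `<` J ->
  exists2 m, lead_monoms le J m & ~ lead_monoms le I m.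
Proof.
move=> iI iJ [sub nsub]; apply: contrapT => no; apply: nsub.
have {}no m : lead_monoms le J m -> lead_monoms le I m.
  by move=> Jm; apply: contrapT => nIm; apply: no; exists m.
suff H m f : J f -> (forall k, k \in msupp f -> le k m) -> I f.
  move=> f Jf; have [->|f0] := eqVneq f 0; first exact: ideal0.
  by have [m [_ fm]] := initial_monom_exists mo f0; apply: (H m).
elim/(mole_ind mo): m f => m IH f Jf fm.
have [->|f0] := eqVneq f 0; first exact: ideal0.
have [k [kf kl]] := initial_monom_exists mo f0.
have [|g Ig [g1 gl]] := lead_monic iI (no k _); first by exists f.
rewrite -[f](subrK (f@_k *: g)).
have Icg : I (f@_k *: g) by rewrite -mul_mpolyC; apply: ideal_mull.
have Jd : J (f - f@_k *: g) by apply: idealB => //; apply: sub.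
apply: idealD => //; have [->|d0] := eqVneq (f - f@_k *: g) 0; first exact: ideal0.
have [l [ld ll]] := initial_monom_exists mo d0.
have lk : le l k.
  by move/msuppB_le: ld; rewrite mem_cat => /orP[/kl//|/msuppZ_le/gl].
apply: (IH l) => //.
  by apply: (mole_trans mo lk); apply: fm.
move=> elm; have ek : k = l.
  by apply: (mole_anti mo) => //; rewrite elm; apply: fm.
by move: ld; rewrite mcoeff_msupp mcoeffB mcoeffZ -ek g1 mulr1 subrr eqxx.
Qed.

(** A strictly increasing sequence in [C] gives monomials [m i] leading in the ideal [s i.+1] but
    not in [s i]. By [dickson] some [m i] divides a later [m j], which is then already leading in
    [s j]. *)
Lemma mpoly_noetherian (C : set (set {mpoly K[n]})) :
  (forall I, C I -> is_ideal I) -> (exists I, C I) ->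
  exists2 I, C I & forall J, C J -> ~ I `<` J.
Proof.
move=> Ci [I0 CI0]; apply: contrapT => no.
have step I : exists J, C I -> C J /\ I `<` J.
  have [CI|nCI] := pselect (C I); last by exists I.
  apply: contrapT => noJ; apply: no; exists I => // J CJ ltIJ.
  by apply: noJ; exists J.
have [g gP] := choice step.
pose s i := iter i g I0.
have sC i : C (s i) by elim: i => // i IH; have [] := gP _ IH.
have slt i : s i `<` s i.+1 by have [] := gP _ (sC i).
have sle i j : (i <= j)%N -> s i `<=` s j.
  move=> /subnK <-; elim: (j - i)%N => [|d IH] //; rewrite addSn.
  by apply: (subset_trans IH); case: (slt (d + i)%N).
have lm i : exists m, lead_monoms le (s i.+1) m /\ ~ lead_monoms le (s i) m.
  by have [m m1 m2] := lead_monoms_proper (Ci _ (sC i)) (Ci _ (sC i.+1)) (slt i); exists m.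
have [m mP] := choice lm.
have [i [j [ltij d]]] := dickson m.
apply: (mP j).2; apply: (lead_monoms_dvd mo) d; first exact/Ci/sC.
exact: lead_monoms_sub (sle _ _ ltij) _ (mP i).1.
Qed.
End Noetherian.

Section Adjoin.
Variable R : comNzRingType.
Implicit Types (I P : set R).

Definition adjoin I x : set R := [set z | exists i r, I i /\ z = i + r * x].

Lemma is_ideal_adjoin I x : is_ideal I -> is_ideal (adjoin I x).
Proof.
move=> iI; split=> [|_ _ [i [r [Ii ->]]] [j [t [Ij ->]]]|t _ [i [r [Ii ->]]]].
- by exists 0, 0; rewrite mul0r addr0; split=> //; apply: ideal0.
- exists (i + j), (r + t); rewrite mulrDl addrACA; split=> //.
  exact: idealD.
- exists (t * i), (t * r); rewrite mulrDr mulrA; split=> //.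
  exact: ideal_mull.
Qed.

Lemma sub_adjoin I x : I `<=` adjoin I x.
Proof. by move=> i Ii; exists i, 0; rewrite mul0r addr0. Qed.

Lemma adjoin_mem I x : is_ideal I -> adjoin I x x.
Proof. by move=> iI; exists 0, 1; rewrite add0r mul1r; split=> //; apply: ideal0. Qed.

Lemma radical_adjoin I x y r : is_ideal I -> I (x * y) ->
  radical (adjoin I x) r -> radical (adjoin I y) r -> radical I r.
Proof.
move=> iI Ixy [k [i [a [Ii ek]]]] [l [j [b [Ij el]]]].
exists (k + l)%N; rewrite exprD ek el mulrDl; apply: idealD => //.
  exact: ideal_mulr.
rewrite mulrDr; apply: idealD => //; first exact: ideal_mull.
by rewrite mulrACA; apply: ideal_mull.
Qed.

Lemma radical_sub_prime I P : is_prime P -> I `<=` P -> radical I `<=` P.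
Proof. by move=> pP IP x [k /IP]; apply: prime_expr. Qed.

Lemma is_ideal_radical I : is_ideal I -> is_ideal (radical I).
Proof.
move=> iI; split=> [|x y [k Ik] [l Il]|r x [k Ik]].
- by exists 1%N; rewrite expr1; apply: ideal0.
- exists (k + l)%N; rewrite exprDn; apply: ideal_sum => // i _.
  rewrite -mulr_natr; apply: ideal_mulr => //.
  have [leil|ltli] := leqP i l.
    apply: ideal_mulr => //; rewrite -addnBA // exprD; exact: ideal_mulr.
  by apply: ideal_mull => //; rewrite -(subnK (ltnW ltli)) exprD; apply: ideal_mull.
- by exists k; rewrite exprMn; apply: ideal_mull.
Qed.

Lemma ideal_exp_sub I P m : I `<=` P -> ideal_exp I m `<=` ideal_exp P m.
Proof.
move=> IP; elim: m => [|m IH] //; rewrite /ideal_exp !iterS.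
apply: ideal_gen_sub => _ [x Ix [y Iy <-]].
by exists x; [apply: IP|exists y => //; apply: IH].
Qed.
End Adjoin.

Section Decomposition.
Variables (K : fieldType) (n : nat) (le : rel 'X_{1..n}).
Hypothesis mo : monomial_order le.
Implicit Types I J : set {mpoly K[n]}.

(** Noetherian induction: an ideal maximal among those without such a family is not the unit ideal,
    served by the empty family, and not prime. So it contains some [x * y] with [x] and [y] outside,
    and the families for the two ideals obtained by adjoining [x] or [y] together serve it. *)
Lemma radical_prime_cover I : is_ideal I ->
  exists (T : finType) (P : T -> set {mpoly K[n]}),
    (forall t, is_prime (P t) /\ I `<=` P t) /\
    forall x, (forall t, P t x) -> radical I x.
Proof.
move=> iI; apply: contrapT => bad.
pose good J := exists (T : finType) (P : T -> set {mpoly K[n]}),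
    (forall t, is_prime (P t) /\ J `<=` P t) /\
    forall x, (forall t, P t x) -> radical J x.
have [|//| J [iJ badJ] maxJ] :=
    @mpoly_noetherian K n le mo [set J | is_ideal J /\ ~ good J].
- by move=> J [].
- by exists I.
have J1 : ~ J 1.
  move=> J1; apply: badJ; exists void, (of_void _); split=> [[]|x _].
  by exists 0%N; rewrite expr0.
apply: badJ.
have [[x [y [Jxy [nJx nJy]]]]|prJ] :=
    pselect (exists x y, J (x * y) /\ (~ J x /\ ~ J y)); last first.
  exists unit, (fun=> J); split=> [_|x /(_ tt) Jx]; last by exists 1%N.
  split=> //; split=> // x y Jxy; apply: contrapT => /not_orP[nx ny].
  by apply: prJ; exists x, y.
have goodadj z : ~ J z -> good (adjoin J z).
  move=> nJz; apply: contrapT => badz; apply: (maxJ (adjoin J z)).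
    by split=> //; apply: is_ideal_adjoin.
  split; first exact: sub_adjoin.
  by move=> /(_ z) sub; apply: nJz; apply: sub; apply: adjoin_mem.
have [T [P [PT TJ]]] := goodadj x nJx.
have [U [Q [QU UJ]]] := goodadj y nJy.
exists (T + U)%type, (fun t => match t with inl t => P t | inr u => Q u end).
split=> [[t|u]|z PQz].
- by have [pP sP] := PT t; split=> //; apply: subset_trans sP; apply: sub_adjoin.
- by have [pP sP] := QU u; split=> //; apply: subset_trans sP; apply: sub_adjoin.
apply: (radical_adjoin iJ Jxy).
  by apply: TJ => t; apply: (PQz (inl t)).
by apply: UJ => t; apply: (PQz (inr t)).
Qed.

(** In an irredundant family, [z t] witnesses that [P t] cannot be dropped. A prime [Q] between [I]
    and [P t] contains some [P t'], or else a product of elements [w t'] would be in the radical but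
    not in [Q]; then [z t] forces [t' = t]. *)
Lemma radical_minimal_primes I : is_ideal I ->
  exists (T : finType) (P : T -> set {mpoly K[n]}) (z : T -> {mpoly K[n]}),
    [/\ forall t, minimal_prime I (P t),
        forall x, radical I x <-> forall t, P t x,
        forall t, ~ P t (z t)
      & forall t t', t' != t -> P t' (z t)].
Proof.
move=> iI; have [T [P [PT TI]]] := radical_prime_cover iI.
pose cover (A : {set T}) := forall x, (forall t, t \in A -> P t x) -> radical I x.
have [A [cA minA]] : exists A, cover A /\ forall t, t \in A -> ~ cover (A :\ t)%SET.
  have : cover [set: T]%SET by move=> x Px; apply: TI => t; apply: Px.
  have [k] := ubnP #|[set: T]%SET|; elim: k [set: T]%SET => // k IH A.
  rewrite ltnS => leA cA.
  have [[t [tA ct]]|no] := pselect (exists t, t \in A /\ cover (A :\ t)%SET).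
    apply: (IH _ _ ct); apply: leq_trans leA.
    by rewrite [X in (_ < X)%N](cardsD1 t) tA.
  by exists A; split=> // t tA ct; apply: no; exists t.
pose S := {t : T | t \in A}.
have zex (t : S) : exists z, ~ P (val t) z /\ forall t', t' \in A -> t' != val t -> P t' z.
  have /existsNP[z /not_implyP[zP nz]] := minA _ (valP t).
  exists z; split=> [Pz|t' t'A net]; last by apply: zP; rewrite !inE net.
  apply: nz; apply: cA => t' t'A; have [->//|net] := eqVneq t' (val t).
  by apply: zP; rewrite !inE net.
have [z zP] := choice zex.
exists S, (fun t => P (val t)), z; split=> [t|x|t|t t' net].
- have [pP sP] := PT (val t); split=> // Q pQ IQ QP.
  apply/seteqP; split=> //.
  have [t' sub] : exists t' : S, P (val t') `<=` Q.
    apply: contrapT => no.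
    have ex (t' : S) : exists x, P (val t') x /\ ~ Q x.
      apply: contrapT => nox; apply: no; exists t' => x Px.
      by apply: contrapT => nQx; apply: nox; exists x.
    have [w wP] := choice ex.
    have [iQ Q1 _] := pQ.
    have : Q (\prod_t' w t').
      apply: (radical_sub_prime pQ IQ); apply: cA => u uA.
      rewrite (bigD1 (exist _ u uA : S)) //=; apply: ideal_mulr; last exact: (wP (exist _ u uA)).1.
      exact: prime_ideal (PT u).1.
    apply: (big_ind (fun x => ~ Q x)) => [//|x y|t' _]; first exact: prime_mulN.
    exact: (wP t').2.
  have [ett|net] := eqVneq t' t; first by rewrite -ett.
  have [nz /(_ _ (valP t'))] := zP t; rewrite (inj_eq val_inj) net => /(_ isT) Pz.
  by case: nz; apply: QP; apply: sub.
- split=> [rx t|Px]; first by apply: radical_sub_prime rx; case: (PT (val t)).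
  by apply: cA => t tA; apply: (Px (exist _ t tA)).
- exact: (zP t).1.
- by apply: (zP t).2; [exact: valP|rewrite (inj_eq val_inj)].
Qed.
End Decomposition.

(** * Powers of ideals *)

Section IdealPowers.
Variables (R : comNzRingType) (h : nat) (y : 'I_h -> R).
Implicit Types (d m : nat) (P : set R).

(** The [d]-th power of the ideal generated by the [y i], given by monomials so that exponents can
    be counted. *)
Definition ideal_pow d : set R :=
  ideal_gen [set x | exists2 e : 'I_h -> nat,
    (\sum_i e i)%N = d & x = \prod_i y i ^+ e i].

Lemma is_ideal_pow d : is_ideal (ideal_pow d).
Proof. exact: is_ideal_gen. Qed.

Lemma ideal_powM d d' x x' :
  ideal_pow d x -> ideal_pow d' x' -> ideal_pow (d + d') (x * x').
Proof.
move=> px; move: x'.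
apply: (@ideal_gen_min _ _ [set x' | ideal_pow (d + d') (x * x')]).
  split=> [|a b|r a] /=; first by rewrite mulr0; exact: ideal0 (is_ideal_pow _).
    by rewrite mulrDr; exact: idealD (is_ideal_pow _).
  by rewrite mulrCA; exact: ideal_mull (is_ideal_pow _).
move=> _ [e' se' ->]; rewrite /= mulrC; move: x px.
set p' := \prod_i _.
apply: (@ideal_gen_min _ _ [set x | ideal_pow (d + d') (p' * x)]).
  split=> [|a b|r a] /=; first by rewrite mulr0; exact: ideal0 (is_ideal_pow _).
    by rewrite mulrDr; exact: idealD (is_ideal_pow _).
  by rewrite mulrCA; exact: ideal_mull (is_ideal_pow _).
move=> _ [e se ->]; apply: sub_ideal_gen.
exists (fun i => e i + e' i)%N; first by rewrite big_split /= se se'.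
by rewrite mulrC -big_split; apply: eq_bigr => i _; rewrite exprD.
Qed.

Lemma ideal_pow0 x : ideal_pow 0 x.
Proof.
rewrite -[x]mulr1; apply: (ideal_mull x (is_ideal_pow 0)).
apply: sub_ideal_gen; exists (fun=> 0%N); first by rewrite big1.
by rewrite big1 // => i _; rewrite expr0.
Qed.

Lemma ideal_powX d x k : ideal_pow d x -> ideal_pow (d * k) (x ^+ k).
Proof.
move=> px; elim: k => [|k IH]; first by rewrite muln0; apply: ideal_pow0.
by rewrite exprS mulnS; apply: ideal_powM.
Qed.

Lemma ideal_gen_pow1 : ideal_gen (range y) `<=` ideal_pow 1.
Proof.
apply: ideal_gen_sub => _ [i _ <-]; exists (fun j => (j == i) : nat).
  by rewrite (bigD1 i) //= eqxx big1 // => j /negPf ->.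
rewrite (bigD1 i) //= eqxx expr1 big1 ?mulr1 // => j /negPf ->.
by rewrite expr0.
Qed.

Lemma ideal_exp_saturation P m : is_prime P ->
  P `<=` saturation P (ideal_gen (range y)) ->
  ideal_exp P m `<=` saturation P (ideal_pow m).
Proof.
move=> pP gen; have [_ P1 _] := pP.
elim: m => [|m IH].
  by move=> x _; exists 1 => //; apply: ideal_pow0.
rewrite /ideal_exp iterS -/(ideal_exp P m); apply: ideal_gen_min.
  by apply: is_ideal_saturation => //; apply: is_ideal_pow.
move=> _ [x /gen[s Ps sx] [x' /IH[t Pt tx'] <-]].
exists (s * t); first exact: prime_mulN.
by rewrite mulrACA -add1n; apply: ideal_powM => //; apply: ideal_gen_pow1.
Qed.

(** A finite type, so that membership in [ideal_pow] is an identity with finitely many coefficients,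
    which can be reduced to a finite field. *)
Definition exponents d := {e : {ffun 'I_h -> 'I_d.+1} | (\sum_i e i == d)%N}.

Definition exponent_monom d (e : exponents d) : R := \prod_i y i ^+ val e i.

Lemma ideal_powP d x : ideal_pow d x <->
  exists c : exponents d -> R, x = \sum_e c e * exponent_monom e.
Proof.
split=> [|[c ->]]; last first.
  apply: ideal_sum => [|e _]; first exact: is_ideal_pow.
  apply: (ideal_mull _ (is_ideal_pow d)).
  apply: sub_ideal_gen; exists (fun i => nat_of_ord (val e i)) => //.
  exact/eqP/(valP e).
move=> px; apply: ideal_gen_range; move: x px.
apply: ideal_gen_sub => _ [e se ->].
have lte i : (e i < d.+1)%N by rewrite ltnS -se (bigD1 i) //= leq_addr.
have sP : (\sum_i [ffun i => Ordinal (lte i)] i == d)%N.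
  by apply/eqP; rewrite -[RHS]se; apply: eq_bigr => i _; rewrite ffunE.
exists (exist (fun e : {ffun 'I_h -> 'I_d.+1} => (\sum_i e i == d)%N) _ sP) => //.
by apply: eq_bigr => i _; rewrite /= ffunE.
Qed.

(* Pigeonhole on the exponents of a monomial in [h] variables. *)
Lemma ideal_pow_frobenius q : (0 < q)%N ->
  ideal_pow (h * q.-1).+1 `<=` ideal_gen (range (fun i => y i ^+ q)).
Proof.
move=> q_gt0; apply: ideal_gen_min; first exact: is_ideal_gen.
move=> _ [e se ->].
have [i leq] : exists i, (q <= e i)%N.
  apply: contrapT => no; have : (\sum_i e i <= h * q.-1)%N.
    rewrite -[X in (_ <= X * _)%N]card_ord -sum_nat_const; apply: leq_sum => i _.
    by rewrite -ltnS prednK // ltnNge; apply/negP => le; apply: no; exists i.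
  by rewrite se ltnn.
rewrite (bigD1 i) //= -(subnK leq) exprD -mulrA mulrCA.
apply: (ideal_mulr _ (is_ideal_gen _)).
by apply: sub_ideal_gen; exists i.
Qed.

(** The element is the product of the power [q.-1] of [s * f] with [s * g], so it lies in the power
    [h * q.-1 + 1] of the ideal of the [y i]. *)
Lemma frobenius_power_mem q s f g : (0 < q)%N ->
  ideal_pow h (s * f) -> ideal_pow 1 (s * g) ->
  ideal_gen (range (fun i => y i ^+ q)) (s ^+ q * (f ^+ q.-1 * g)).
Proof.
move=> q_gt0 sf sg; apply: ideal_pow_frobenius => //.
have -> : s ^+ q = s ^+ q.-1 * s by rewrite -exprSr prednK.
rewrite mulrACA -exprMn -addn1.
by apply: ideal_powM => //; apply: ideal_powX.
Qed.
End IdealPowers.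

(** The multiplier [x] is a unit at [P], so [f] lies locally in the [h]-th power of [P]; one
    denominator [s] serves both [f] and [g]. *)
Lemma local_certificate (K : fieldType) n (P : set {mpoly K[n]}) h x f g :
  is_prime P -> height_le P h -> ~ P x -> ideal_exp P h (f * x) -> P g ->
  exists (y : 'I_h -> {mpoly K[n]}) (s : {mpoly K[n]}),
    [/\ ~ P s, forall i, P (y i), ideal_pow y h (s * f) & ideal_pow y 1 (s * g)].
Proof.
move=> pP hP nPx Pfx Pg.
have [k [y0 [c [ch Py0 gen0]]]] := locally_generated_mpoly pP.
have lekh : (k <= h)%N := hP _ _ ch.
(* The [k] local generators are padded with zeros to exactly [h]. *)
pose y (i : 'I_h) := oapp y0 0 (insub (val i)).
have gen : P `<=` saturation P (ideal_gen (range y)).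
  apply: (subset_trans gen0) => a [s Ps sa]; exists s => //.
  apply: ideal_gen_sub sa => _ [i _ <-]; exists (widen_ord lekh i) => //.
  by rewrite /y /= valK.
have [s Ps sfx] := ideal_exp_saturation pP gen Pfx.
have [t Pt tg] := gen _ Pg.
exists y, (t * (s * x)); split.
- by do 2! [apply: prime_mulN => //].
- move=> i; rewrite /y; case: insub => //=; exact: ideal0 (prime_ideal pP).
- rewrite -mulrA; apply: (ideal_mull _ (is_ideal_pow _ _)).
  by rewrite -mulrA [x * f]mulrC.
- rewrite mulrAC mulrC; apply: (ideal_mull _ (is_ideal_pow _ _)).
  exact: ideal_gen_pow1.
Qed.

(** * A functional with finitely generated values *)

Section LinearExtension.
Variables (n : nat) (R : comNzRingType) (c : 'X_{1..n} -> R).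
Implicit Types F G : {mpoly R[n]}.

Definition lin_ext F : R := \sum_(m <- msupp F) F@_m * c m.

Lemma lin_extE F k : (msize F <= k)%N ->
  lin_ext F = \sum_(m : 'X_{1..n < k}) F@_m * c m.
Proof.
move=> le_pi; set I : subFinType _ := 'X_{1..n < k}.
rewrite /lin_ext (big_mksub I) ?msupp_uniq //=; first last.
  by move=> x /msize_mdeg_lt /leq_trans; apply.
by rewrite big_rmcond //= => j /memN_msupp_eq0 ->; rewrite mul0r.
Qed.

Lemma lin_extD F G : lin_ext (F + G) = lin_ext F + lin_ext G.
Proof.
pose k := maxn (msize F) (msize G).
rewrite !(@lin_extE _ k) ?leq_maxl ?leq_maxr ?msizeD_le // -big_split.
by apply: eq_bigr => m _; rewrite mcoeffD mulrDl.
Qed.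

Lemma lin_extZ a F : lin_ext (a *: F) = a * lin_ext F.
Proof.
rewrite !(@lin_extE _ (msize F)) ?msizeZ_le // mulr_sumr.
by apply: eq_bigr => m _; rewrite mcoeffZ mulrA.
Qed.

Lemma lin_ext0 : lin_ext 0 = 0.
Proof. by rewrite /lin_ext msupp0 big_nil. Qed.

Lemma lin_extX m : lin_ext 'X_[m] = c m.
Proof. by rewrite /lin_ext msuppX big_seq1 mcoeffX eqxx mul1r. Qed.

Lemma lin_ext_sum (T : Type) (s : seq T) (D : pred T) (F : T -> {mpoly R[n]}) :
  lin_ext (\sum_(i <- s | D i) F i) = \sum_(i <- s | D i) lin_ext (F i).
Proof. by apply: (big_morph lin_ext lin_extD lin_ext0). Qed.
End LinearExtension.

Lemma lin_ext_map n (R S : comNzRingType) (a : {rmorphism R -> S})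
    (c : 'X_{1..n} -> R) (F : {mpoly R[n]}) :
  lin_ext (a \o c) (map_mpoly a F) = a (lin_ext c F).
Proof.
elim/mpolyind: F => [|x m p _ _ IH]; first by rewrite !rmorph0 !lin_ext0 rmorph0.
rewrite rmorphD /= !lin_extD IH rmorphD; congr (_ + _).
by rewrite map_mpolyZ map_mpolyX !lin_extZ !lin_extX rmorphM.
Qed.

Section Functional.
Variables (K : fieldType) (n : nat) (le : rel 'X_{1..n}).
Hypothesis mo : monomial_order le.
Variable J : set {mpoly K[n]}.
Hypothesis iJ : is_ideal J.

Section Liftable.
Variables (R : comNzRingType) (a : {rmorphism R -> K}).
Implicit Types f g : {mpoly K[n]}.

Lemma liftable0 : liftable a (0 : {mpoly K[n]}).
Proof. by exists 0; rewrite rmorph0. Qed.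

Lemma liftableD f g : liftable a f -> liftable a g -> liftable a (f + g).
Proof. by move=> [F <-] [G <-]; exists (F + G); rewrite rmorphD. Qed.

Lemma liftableM f g : liftable a f -> liftable a g -> liftable a (f * g).
Proof. by move=> [F <-] [G <-]; exists (F * G); rewrite rmorphM. Qed.

Lemma liftableZ r f : liftable a f -> liftable a (a r *: f).
Proof. by move=> [F <-]; exists (r *: F); rewrite map_mpolyZ. Qed.

Lemma liftableX m : liftable a ('X_[m] : {mpoly K[n]}).
Proof. by exists 'X_[m]; rewrite map_mpolyX. Qed.

Lemma normal_form (B : seq {mpoly K[n]}) :
  groebner le J B -> (forall b, b \in B -> liftable a b) ->
  forall f, liftable a f ->
  exists r, [/\ liftable a r, standard le J r & J (f - r)].
Proof.
move=> gB lB f.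
apply: (division_closure mo (D := J)
  (E := [set f | exists r, [/\ liftable a r, standard le J r & J (f - r)]]) gB lB).
- by exists 0; split; [exact: liftable0|move=> m; rewrite msupp0|rewrite subrr; exact: ideal0].
- move=> f1 f2 [r1 [l1 s1 J1]] [r2 [l2 s2 J2]]; exists (r1 + r2).
  split; [exact: liftableD|exact: standardD|].
  by rewrite opprD addrACA; apply: idealD.
- move=> r f1 [r1 [l1 s1 J1]]; exists (a r *: r1).
  split; [exact: liftableZ|exact: standardZ|].
  by rewrite -scalerBr -mul_mpolyC; apply: ideal_mull.
- move=> m b bB; exists 0; split; [exact: liftable0|by move=> k; rewrite msupp0|].
  by rewrite subr0; apply: ideal_mull => //; case: gB => + _; apply.
- move=> m nJm; exists 'X_[m]; split; [exact: liftableX|exact: standardX|].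
  by rewrite subrr; apply: ideal0.
Qed.
End Liftable.

Variables (T : {mpoly K[n]}) (u : 'X_{1..n}).
Hypothesis nzdT : forall f, J (T * f) -> J f.
Hypothesis nJu : ~ lead_monoms le J u.

Let JT := adjoin J T.

(* [r'] is, modulo [J], the quotient by [T] of the part of [f] lying in
   [J + (T)], along the standard monomials of [J + (T)]. *)
Let splits (f r' : {mpoly K[n]}) := exists r,
  [/\ standard le JT r, standard le J r' & J (f - r - T * r')].

Let splitsD f1 f2 r1 r2 :
  splits f1 r1 -> splits f2 r2 -> splits (f1 + f2) (r1 + r2).
Proof.
move=> [s1 [h1 h1' J1]] [s2 [h2 h2' J2]]; exists (s1 + s2).
split; [exact: standardD|exact: standardD|].
have -> : f1 + f2 - (s1 + s2) - T * (r1 + r2) =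
    (f1 - s1 - T * r1) + (f2 - s2 - T * r2) by ring.
exact: idealD.
Qed.

Let splitsZ c f r : splits f r -> splits (c *: f) (c *: r).
Proof.
move=> [s [h1 h2 J1]]; exists (c *: s); split; [exact: standardZ|exact: standardZ|].
by rewrite -scalerAr -!scalerBr -mul_mpolyC; apply: ideal_mull.
Qed.

Let splits0 : splits 0 0.
Proof.
by exists 0; split; [move=> k; rewrite msupp0..|rewrite mulr0 !subr0; exact: ideal0].
Qed.

(** The standard part [s] lies in [JT], so it is 0, and cancelling [T] puts [r - g] in [J]. If [u]
    occurred in [r - g], its leading monomial would be at least [u]; as [r] is standard it would
    come from [g], hence equal [u], which is not leading in [J]. *)
Let splits_coef f g r : splits f r -> J (f - T * g) ->
  (forall m, m \in msupp g -> le m u) -> r@_u = g@_u.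
Proof.
move=> [s [hs hr Js]] Jf gu.
have Jd : J (s + T * (r - g)).
  have -> : s + T * (r - g) = (f - T * g) - (f - s - T * r) by ring.
  exact: idealB.
have s0 : s = 0.
  apply: (standard_eq0 mo (D := JT)) hs.
  exists (s + T * (r - g)), (g - r); split=> //.
  by ring.
rewrite s0 add0r in Jd; have {Jd} Jd := nzdT Jd.
apply/eqP; rewrite -subr_eq0 -mcoeffB; apply/negPn/negP => nz.
have d0 : r - g != 0 by apply: contraNneq nz => ->; rewrite mcoeff0.
have [v [vd vl]] := initial_monom_exists mo d0.
have Jv : lead_monoms le J v by exists (r - g).
have leuv : le u v by apply: vl; rewrite mcoeff_msupp.
have vg : v \in msupp g.
  move/msuppB_le: vd; rewrite mem_cat => /orP[/hr|//].
  by move=> /(_ Jv).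
by apply: nJu; rewrite (mole_anti mo leuv (gu _ vg)).
Qed.

(* The functional [f |-> r'@_u] takes its values on monomials in a finitely
   generated subring, so that it can be reduced to positive characteristic. *)
Lemma colon_functional : exists B : seq {mpoly K[n]},
  forall (R : comNzRingType) (a : {rmorphism R -> K}),
  (forall b, b \in B -> liftable a b) ->
  exists c : 'X_{1..n} -> R,
    (forall f, J f -> lin_ext (a \o c) f = 0) /\
    (forall g, (forall m, m \in msupp g -> le m u) ->
       lin_ext (a \o c) (T * g) = g@_u).
Proof.
have iJT : is_ideal JT by apply: is_ideal_adjoin.
have [BJ gJ] := groebner_exists le iJ.
have [BT gT] := groebner_exists le iJT.
have step b : exists Q, b \in BT -> J (b - Q * T).
  have [/gT.1[j [Q [Jj ->]]]|_] := boolP (b \in BT); last by exists 0.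
  by exists Q; rewrite addrK.
have [Q QP] := choice step.
(* All the divisions below use only the coefficients of the two bases and of the quotients [Q b] of
   the basis of [JT] by [T] modulo [J]. *)
exists (BJ ++ BT ++ map Q BT) => R a lB.
have lJ b : b \in BJ -> liftable a b by move=> bB; apply: lB; rewrite mem_cat bB.
have lT b : b \in BT -> liftable a b by move=> bB; apply: lB; rewrite !mem_cat bB orbT.
have lQ b : b \in BT -> liftable a (Q b).
  by move=> bB; apply: lB; rewrite !mem_cat (map_f Q bB) !orbT.
have spl m : exists r', liftable a r' /\ splits 'X_[m] r'.
  apply: (division_closure mo (D := JT)
    (E := [set f | exists r', liftable a r' /\ splits f r']) gT lT).
  - by exists 0; split; [exact: liftable0|exact: splits0].
  - move=> f1 f2 [r1 [l1 s1]] [r2 [l2 s2]]; exists (r1 + r2).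
    by split; [exact: liftableD|exact: splitsD].
  - move=> r f1 [r1 [l1 s1]]; exists (a r *: r1).
    by split; [exact: liftableZ|exact: splitsZ].
  - move=> k b bB.
    have lXQ : liftable a ('X_[k] * Q b) by apply: liftableM (lQ _ bB); exact: liftableX.
    have [r [lr sr Jr]] := normal_form gJ lJ lXQ.
    (* Modulo [J], a multiple of [b] is [T] times the same multiple of [Q b], whose normal form is
       the quotient. *)
    exists r; split=> //; exists 0; split=> //; first by move=> l; rewrite msupp0.
    have -> : 'X_[k] * b - 0 - T * r =
        'X_[k] * (b - Q b * T) + T * ('X_[k] * Q b - r) by ring.
    by apply: idealD => //; apply: ideal_mull => //; apply: QP.
  - move=> k nk; exists 0; split; first exact: liftable0.
    exists 'X_[k]; split; [exact: standardX|by move=> l; rewrite msupp0|].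
    by rewrite mulr0 subr0 subrr; apply: ideal0.
  - exact: liftableX.
have step' m : exists x, exists2 r', a x = r'@_u & splits 'X_[m] r'.
  have [r' [[G Gr] sr]] := spl m; exists G@_u, r' => //.
  by rewrite -Gr mcoeff_map_mpoly.
have [c cP] := choice step'.
have ext f : exists2 r', splits f r' & lin_ext (a \o c) f = r'@_u.
  elim/mpolyind: f => [|x m p _ _ [r sr er]].
    by exists 0; [exact: splits0|rewrite lin_ext0 mcoeff0].
  have [r' er' sr'] := cP m; exists (x *: r' + r).
    by apply: splitsD => //; apply: splitsZ.
  by rewrite lin_extD lin_extZ lin_extX /= er' er mcoeffD mcoeffZ.
exists c; split=> [f Jf|g gu].
  have [r sr ->] := ext f; rewrite (splits_coef (g := 0) sr) ?mcoeff0 //.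
    by rewrite mulr0 subr0.
  by move=> m; rewrite msupp0.
have [r sr ->] := ext (T * g); apply: (splits_coef sr) => //.
by rewrite subrr; apply: ideal0.
Qed.
End Functional.

(** * The trace over a finite field *)

Lemma mcoeffXM n (R : comNzRingType) m k (F : {mpoly R[n]}) :
  ('X_[m] * F)@_k = if (m <= k)%MM then F@_(k - m) else 0.
Proof.
case: ifPn => [mk|nmk]; first by rewrite -{1}(submK mk) addmC mulrC mcoeffMX.
apply: memN_msupp_eq0; apply: contra nmk => /msuppM_le /allpairsP[[m' l] /= [+ _ ->]].
by rewrite msuppX inE => /eqP ->; apply: lem_addr.
Qed.

Definition ones n : 'X_{1..n} := [multinom 1%N | _ < n].

Section Trace.
Variables (n : nat) (R : comNzRingType) (q : nat).
Hypothesis q_gt0 : (0 < q)%N.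
Implicit Types F G : {mpoly R[n]}.

Definition trace_exponent (m : 'X_{1..n}) := (m *+ q + ones n *+ q.-1)%MM.

Lemma trace_exponentE m i : trace_exponent m i = (m i * q + q.-1)%N.
Proof. by rewrite mnmDE !mulmnE mnmE mul1n. Qed.

Lemma mdeg_trace_exponent m : (mdeg m <= mdeg (trace_exponent m))%N.
Proof. by rewrite mdegD !mdegMn (leq_trans _ (leq_addr _ _)) // leq_pmulr. Qed.

(* The coefficientwise [q]-th root of [F], followed by the projection onto the
   monomial [X^(q-1,...,q-1)] of the basis of [R[X]] over its [q]-th powers; no
   root is taken, since it is used over fields with [c ^+ q = c]. *)
Definition frob_trace F : {mpoly R[n]} :=
  \sum_(m : 'X_{1..n < msize F}) F@_(trace_exponent m) *: 'X_[m].

Lemma mcoeff_frob_trace F m : (frob_trace F)@_m = F@_(trace_exponent m).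
Proof.
have [lt|le] := ltnP (mdeg m) (msize F).
  by rewrite (mcoeff_mpoly (fun m => F@_(trace_exponent m))).
rewrite [RHS]memN_msupp_eq0; last first.
  by apply: msize_mdeg_ge; apply: leq_trans le (mdeg_trace_exponent m).
rewrite /frob_trace raddf_sum big1 // => k _; rewrite /= mcoeffZ mcoeffX.
case: eqP => [e|_]; last by rewrite mulr0.
by move: (bmdeg k); rewrite e ltnNge le.
Qed.

Lemma frob_traceD F G : frob_trace (F + G) = frob_trace F + frob_trace G.
Proof. by apply/mpolyP => m; rewrite !(mcoeff_frob_trace, mcoeffD). Qed.

Lemma frob_trace0 : frob_trace 0 = 0.
Proof. by apply/mpolyP => m; rewrite mcoeff_frob_trace !mcoeff0. Qed.

Lemma frob_traceZ c F : frob_trace (c *: F) = c *: frob_trace F.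
Proof. by apply/mpolyP => m; rewrite !(mcoeff_frob_trace, mcoeffZ). Qed.

Lemma frob_traceXM m F : frob_trace ('X_[m *+ q] * F) = 'X_[m] * frob_trace F.
Proof.
apply/mpolyP => k; rewrite mcoeff_frob_trace !mcoeffXM mcoeff_frob_trace.
(* The remainder [q.-1] is less than [q], so it does not affect divisibility by a [q]-th power. *)
have -> : (m *+ q <= trace_exponent k)%MM = (m <= k)%MM.
  apply/mnm_lepP/mnm_lepP => H i; have := H i; rewrite trace_exponentE mulmnE.
    by rewrite -ltnS -addnS prednK // -mulSnr ltn_pmul2r.
  by move=> le_mk; rewrite -[X in (X <= _)%N]addn0 leq_add // leq_mul2r le_mk orbT.
case: ifP => // /mnm_lepP mk; congr (F@_ _); apply/mnmP => i.
by rewrite mnmBE !trace_exponentE mnmBE mulmnE mulnBl addnBAC // leq_mul2r mk orbT.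
Qed.
End Trace.

Section FiniteField.
Variables (n : nat) (F : finFieldType) (j : nat).
Let q := (#|F| ^ j)%N.
Implicit Types G H : {mpoly F[n]}.

Let q_gt0 : (0 < q)%N.
Proof. by rewrite expn_gt0 (ltn_trans _ (finNzRing_gt1 F)). Qed.

Lemma expf_card_expn (x : F) : x ^+ q = x.
Proof.
rewrite /q; elim: j => [|k IH]; first by rewrite expn0 expr1.
by rewrite expnS exprM expf_card IH.
Qed.

Lemma frobeniusD_card (x y : {mpoly F[n]}) : (x + y) ^+ q = x ^+ q + y ^+ q.
Proof.
have [p pp pF] := finPcharP F.
have pM : p \in [pchar {mpoly F[n]}] by rewrite pchar_lalg.
have nat_q : p.-nat q.
  have /abelem_pgroup := (fin_ring_pchar_abelem pF).
  by rewrite /pgroup cardsT /q pnatX => ->.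
apply: exprDn_pchar; apply: sub_in_pnat nat_q => r _ /eqP -> //.
Qed.

Lemma frob_traceM G H : frob_trace q (G ^+ q * H) = G * frob_trace q H.
Proof.
elim/mpolyind: G => [|c m G _ _ IH].
  by rewrite expr0n gtn_eqF ?q_gt0 // mulr0n !mul0r frob_trace0.
rewrite frobeniusD_card !mulrDl frob_traceD // IH; congr (_ + _).
rewrite exprZn expf_card_expn mpolyXn -!scalerAl frob_traceZ //.
by rewrite frob_traceXM ?q_gt0 //.
Qed.

Lemma frob_trace_ideal (T : finType) (y : T -> {mpoly F[n]}) H :
  ideal_gen (range (fun i => y i ^+ q)) H -> ideal_gen (range y) (frob_trace q H).
Proof.
move=> /ideal_gen_range[c ->]; elim/big_rec: _ => [|i x _ IH].
  by rewrite frob_trace0 //; apply: ideal0 (is_ideal_gen _).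
rewrite frob_traceD // mulrC frob_traceM; apply: (idealD (is_ideal_gen _)) => //.
by apply: (ideal_mulr _ (is_ideal_gen _)); apply: sub_ideal_gen; exists i.
Qed.

(** Cancelling the common shift gives [k *+ q] below [u *+ q]; if [u] is below [k], the two are
    equal, and so are [k] and [u]. *)
Lemma frob_trace_monic (le : rel 'X_{1..n}) (mo : monomial_order le) G u :
  monic_at le G (trace_exponent q u) -> monic_at le (frob_trace q G) u.
Proof.
move=> [G1 Gl]; split=> [|k]; first by rewrite mcoeff_frob_trace ?q_gt0 //.
rewrite mcoeff_msupp mcoeff_frob_trace ?q_gt0 // -mcoeff_msupp => /Gl.
move/(mole_cancelr mo) => le_ku.
have [//|le_uk] := orP (mole_total mo k u).
have leq_uk j' : le (u *+ j')%MM (k *+ j')%MM.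
  elim: j' => [|j' IH]; first by rewrite !mulm0n; apply: (mole_refl mo).
  by rewrite !mulmS; apply: (moleD mo).
have /mnmP e := mole_anti mo le_ku (leq_uk q).
suff -> : k = u by apply: (mole_refl mo).
apply/mnmP => i; have /eqP := e i; rewrite !mulmnE eqn_pmul2r ?q_gt0 //.
by move/eqP.
Qed.
End FiniteField.

(** * The initial ideal of the radical *)

(** The lifted identity holds over [R] up to the kernel of [a], which [b] kills. *)
Lemma ideal_pow_transfer (R S S' : comNzRingType) (a : {rmorphism R -> S})
    (b : {rmorphism R -> S'}) h d (y : 'I_h -> R) (c : exponents h d -> R) x :
  (forall r, a r = 0 -> b r = 0) ->
  a x = \sum_e a (c e) * exponent_monom (a \o y) e ->
  ideal_pow (b \o y) d (b x).
Proof.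
move=> ker ax; apply/ideal_powP; exists (b \o c).
have mon (S0 : comNzRingType) (f : {rmorphism R -> S0}) :
    \sum_e f (c e) * exponent_monom (f \o y) e =
    f (\sum_e c e * exponent_monom y e).
  rewrite rmorph_sum; apply: eq_bigr => e _; rewrite rmorphM rmorph_prod.
  by congr (_ * _); apply: eq_bigr => i _; rewrite rmorphXn.
apply/eqP; rewrite [X in _ == X]mon -subr_eq0 -rmorphB; apply/eqP/ker.
by rewrite rmorphB ax mon subrr.
Qed.

Lemma lin_ext_delta n (R : comNzRingType) u (F : {mpoly R[n]}) :
  lin_ext (fun m => (m == u)%:R) F = F@_u.
Proof.
elim/mpolyind: F => [|x m p _ _ IH]; first by rewrite lin_ext0 mcoeff0.
by rewrite lin_extD lin_extZ lin_extX IH mcoeffD mcoeffZ mcoeffX.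
Qed.

Lemma mpoly_specialization (K : fieldType) n (L : seq {mpoly K[n]}) :
  exists (R : comNzRingType) (a : {rmorphism R -> K}) (F : finFieldType)
    (b : {rmorphism R -> F}) (up : {mpoly K[n]} -> {mpoly R[n]}),
    (forall r, a r = 0 -> b r = 0) /\
    forall p, p \in L -> map_mpoly a (up p) = p.
Proof.
pose coefs (p : {mpoly K[n]}) := [seq p@_m | m <- msupp p].
have [R [a [F [b [ker lift]]]]] := specialization (flatten (map coefs L)).
have lex x : exists r, x \in flatten (map coefs L) -> a r = x.
  by have [/lift[r ar]|] := boolP (x \in flatten (map coefs L)); [exists r|exists 0].
have [l lP] := choice lex.
exists R, a, F, b, (fun p => \sum_(m <- msupp p) l p@_m *: 'X_[m]); split=> // p pL.
rewrite rmorph_sum [RHS]mpolyE; apply: eq_big_seq => m ms.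
rewrite /= map_mpolyZ map_mpolyX lP //; apply/flattenP; exists (coefs p).
  exact: map_f.
exact: (map_f (fun m => p@_m)).
Qed.

Section RadicalLeading.
Variables (K : fieldType) (n : nat) (le : rel 'X_{1..n}).
Hypothesis mo : monomial_order le.
Variables (I : set {mpoly K[n]}) (h : nat).
Hypothesis iI : is_ideal I.
Hypothesis heightI : forall P, minimal_prime I P -> height_le P h.
Variables f x : {mpoly K[n]}.
Hypothesis nPx : forall P, minimal_prime I P -> ~ P x.
Hypothesis Ifx : ideal_exp I h (f * x).
Hypothesis f_monic : monic_at le f (ones n).

Lemma lead_radical_root u k :
  lead_monoms le (radical I) (u *+ k)%MM -> lead_monoms le (radical I) u.
Proof.
set J := radical I => Juk; apply: contrapT => nJu.
have iJ : is_ideal J by apply: is_ideal_radical.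
have [g Jg gm] := lead_monic iJ Juk.
have [T [P [z [minP radP nPz Pz]]]] := radical_minimal_primes mo iI.
have pP t : is_prime (P t) by case: (minP t).
have cert t : exists ys : ('I_h -> {mpoly K[n]}) * {mpoly K[n]},
    [/\ ~ P t ys.2, forall i, P t (ys.1 i), ideal_pow ys.1 h (ys.2 * f)
      & ideal_pow ys.1 1 (ys.2 * g)].
  have Pg : P t g := (radP g).1 Jg t.
  have Pfx : ideal_exp (P t) h (f * x).
    by apply: ideal_exp_sub Ifx; case: (minP t).
  have [y [s ysP]] :=
    local_certificate (pP t) (heightI (minP t)) (nPx (minP t)) Pfx Pg.
  by exists (y, s).
have [ys ysP] := choice cert; pose y t := (ys t).1; pose s t := (ys t).2.
have nPs t : ~ P t (s t) by rewrite /s; case: (ysP t).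
have Py t i : P t (y t i) by rewrite /y; case: (ysP t).
have cex t : exists e' : exponents h h -> _,
    s t * f = \sum_e e' e * exponent_monom (y t) e.
  by apply/ideal_powP; rewrite /s /y; case: (ysP t).
have [c cP] := choice cex.
have dex t : exists e' : exponents h 1 -> _,
    s t * g = \sum_e e' e * exponent_monom (y t) e.
  by apply/ideal_powP; rewrite /s /y; case: (ysP t).
have [d dP] := choice dex.
(* Modulo [P t] only the term [z t * s t] remains, and it is outside [P t]. As [J] is the
   intersection of the [P t], [theta] is a nonzerodivisor modulo [J]. *)
pose theta := \sum_t z t * s t.
have nzd F : J (theta * F) -> J F.
  move=> JF; apply/radP => t; have iP := prime_ideal (pP t).
  have [_ _ PM] := pP t; have /PM[/PM[/nPz//|/nPs//]|//] : P t (z t * s t * F).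
  have -> : z t * s t * F = theta * F - (\sum_(t' | t' != t) z t' * s t') * F.
    by rewrite /theta (bigD1 t) //= -mulrBl addrK.
  apply: idealB => //; first exact: (radP _).1 JF t.
  apply: ideal_mulr => //; apply: ideal_sum => // t' net.
  by apply: ideal_mulr => //; apply: Pz; rewrite eq_sym.
have Jzy t i : J (z t * y t i).
  apply/radP => t'; have iP := prime_ideal (pP t').
  have [e|net] := eqVneq t' t; first by rewrite e in iP *; apply: ideal_mull.
  by apply: ideal_mulr => //; apply: Pz.
have [B BP] := colon_functional mo iJ nzd nJu.
(* Every polynomial occurring in the identities to be reduced, including the coefficients of the
   membership certificates. *)
pose L := B ++ [:: f; g] ++ codom z ++ codom s ++ codom (fun p => y p.1 p.2)
   ++ codom (fun p => c p.1 p.2) ++ codom (fun p => d p.1 p.2).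
have [R [a [F [b [up [ker upP]]]]]] := mpoly_specialization L.
have upf : map_mpoly a (up f) = f by apply: upP; rewrite !mem_cat mem_head !orbT.
have upg : map_mpoly a (up g) = g by apply: upP; rewrite !mem_cat !inE eqxx !orbT.
have upz t : map_mpoly a (up (z t)) = z t by apply: upP; rewrite !mem_cat codom_f !orbT.
have ups t : map_mpoly a (up (s t)) = s t by apply: upP; rewrite !mem_cat codom_f !orbT.
have upy t i : map_mpoly a (up (y t i)) = y t i.
  by apply: upP; rewrite !mem_cat (codom_f (fun p => y p.1 p.2) (t, i)) !orbT.
have upc t e : map_mpoly a (up (c t e)) = c t e.
  by apply: upP; rewrite !mem_cat (codom_f (fun p => c p.1 p.2) (t, e)) !orbT.
have upd t e : map_mpoly a (up (d t e)) = d t e.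
  by apply: upP; rewrite !mem_cat (codom_f (fun p => d p.1 p.2) (t, e)) !orbT.
have [lam [lam0 lam1]] : exists lam : 'X_{1..n} -> R,
    (forall G, J G -> lin_ext (a \o lam) G = 0) /\
    (forall G, (forall m, m \in msupp G -> le m u) ->
       lin_ext (a \o lam) (theta * G) = G@_u).
  by apply: BP => p pB; exists (up p); apply: upP; rewrite mem_cat pB.
have ker' G : map_mpoly a G = 0 -> map_mpoly b G = 0 :> {mpoly F[n]}.
  move=> /mpolyP aG; apply/mpolyP => m; rewrite mcoeff_map_mpoly mcoeff0.
  by apply: ker; have := aG m; rewrite mcoeff_map_mpoly mcoeff0.
pose v p := map_mpoly b (up p).
have v_monic p m : map_mpoly a (up p) = p -> monic_at le p m -> monic_at le (v p) m.
  move=> upp [p1 pl]; split=> [|l]; rewrite /v ?mcoeff_msupp mcoeff_map_mpoly /=.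
    apply/eqP; rewrite -(rmorph1 b) -subr_eq0 -rmorphB; apply/eqP/ker.
    by rewrite rmorphB rmorph1 -mcoeff_map_mpoly upp p1 subrr.
  move=> nz; apply: pl; rewrite mcoeff_msupp; apply: contraNneq nz => pl0.
  by apply/eqP/ker; rewrite -mcoeff_map_mpoly upp.
have vsf t : ideal_pow (v \o y t) h (v (s t) * v f).
  rewrite /v -rmorphM.
  apply: (ideal_pow_transfer (y := up \o y t) (c := up \o c t) ker').
  rewrite rmorphM /= ups upf cP; apply: eq_bigr => e _.
  by rewrite upc /exponent_monom; congr (_ * _); apply: eq_bigr => i _; rewrite /= upy.
have vsg t : ideal_pow (v \o y t) 1 (v (s t) * v g).
  rewrite /v -rmorphM.
  apply: (ideal_pow_transfer (y := up \o y t) (c := up \o d t) ker').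
  rewrite rmorphM /= ups upg dP; apply: eq_bigr => e _.
  by rewrite upd /exponent_monom; congr (_ * _); apply: eq_bigr => i _; rewrite /= upy.
(* This power of the order of [F] is at least [k], as the factor [u *+ (q - k)] requires. *)
pose q := (#|F| ^ k)%N.
have leqkq : (k <= q)%N by apply/ltnW/ltn_expl/finNzRing_gt1.
have q_gt0 : (0 < q)%N by rewrite expn_gt0 (ltn_trans _ (finNzRing_gt1 F)).
pose phi := v f ^+ q.-1 * ('X_[u *+ (q - k)] * v g).
have phi_monic : monic_at le phi (trace_exponent q u).
  have -> : trace_exponent q u = (ones n *+ q.-1 + (u *+ (q - k) + u *+ k))%MM.
    rewrite /trace_exponent addmC; congr (_ + _)%MM; apply/mnmP => i.
    by rewrite mnmDE !mulmnE -mulnDr subnK.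
  apply: (monic_atM mo); first by apply: (monic_atXn mo); apply: v_monic.
  by apply: (monic_atM mo); [exact: monic_atX|exact: v_monic].
pose psi := frob_trace q phi.
have [psi1 psil] : monic_at le psi u by apply: frob_trace_monic.
have psi_mem t : ideal_gen (range (v \o y t)) (v (s t) * psi).
  rewrite /psi -frob_traceM; apply: frob_trace_ideal.
  apply: frobenius_power_mem => //.
  by rewrite mulrCA; apply: (ideal_mull _ (is_ideal_pow _ _)).
(* Over [K] the functional vanishes on [J], which contains [z t * y t i]; for [H] a monomial the
   vanishing is a relation between elements of [R], hence survives in [F]. *)
have ext0 t i H : lin_ext (b \o lam) (H * (v (z t) * v (y t i))) = 0.
  elim/mpolyind: H => [|r m H _ _ IH]; first by rewrite mul0r lin_ext0.
  rewrite mulrDl lin_extD IH addr0 -scalerAl lin_extZ.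
  rewrite /v -(map_mpolyX b) -!rmorphM lin_ext_map ker ?mulr0 //.
  rewrite -lin_ext_map !rmorphM /= upz upy lam0 //; exact: ideal_mull.
have ext1 m : le m u ->
    lin_ext (b \o lam) ((\sum_t v (z t) * v (s t)) * 'X_[m]) = (m == u)%:R.
  move=> le_mu; pose theta' := \sum_t up (z t) * up (s t).
  have -> : \sum_t v (z t) * v (s t) = map_mpoly b theta'.
    by rewrite rmorph_sum; apply: eq_bigr => t _; rewrite rmorphM.
  have atheta : map_mpoly a theta' = theta.
    by rewrite rmorph_sum; apply: eq_bigr => t _; rewrite rmorphM /= upz ups.
  rewrite -(map_mpolyX b) -rmorphM lin_ext_map.
  apply/eqP; rewrite -(rmorph_nat b) -subr_eq0 -rmorphB; apply/eqP/ker.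
  rewrite rmorphB rmorph_nat -lin_ext_map rmorphM /= atheta map_mpolyX lam1.
    by rewrite mcoeffX subrr.
  by move=> l; rewrite msuppX inE => /eqP ->.
(* The value is the coefficient of [u] in [psi], which has no monomial above [u]. It is also 0,
   since each [v (s t) * psi] lies in the ideal of the [v (y t i)]. *)
have : lin_ext (b \o lam) ((\sum_t v (z t) * v (s t)) * psi) = 1.
  rewrite -psi1 -lin_ext_delta {1}[psi]mpolyE mulr_sumr lin_ext_sum.
  apply: eq_big_seq => m /psil /ext1 <-.
  by rewrite -scalerAr lin_extZ.
rewrite mulr_suml lin_ext_sum big1 => [/eqP|t _]; first by rewrite eq_sym oner_eq0.
(* Quantifying over the multiplier [H] makes [N] an ideal, so it is enough to test generators. *)
pose N := [set G | forall H, lin_ext (b \o lam) (H * (v (z t) * G)) = 0].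
have iN : is_ideal N.
  split=> [H|G1 G2 N1 N2 H|G1 G2 NG H]; first by rewrite !mulr0 lin_ext0.
    by rewrite !mulrDr lin_extD N1 N2 addr0.
  have -> : H * (v (z t) * (G1 * G2)) = H * G1 * (v (z t) * G2) by ring.
  exact: NG.
have : N (v (s t) * psi).
  apply: (ideal_gen_min iN _ (psi_mem t)) => _ [i _ <-] H.
  exact: ext0.
by move/(_ 1); rewrite mul1r mulrA.
Qed.
End RadicalLeading.

Lemma is_ideal_exp (R : comNzRingType) (I : set R) m : is_ideal (ideal_exp I m).
Proof.
case: m => [|m]; first by split.
by rewrite /ideal_exp iterS; apply: is_ideal_gen.
Qed.

Lemma monom_ideal_dvd (K : fieldType) n (M : set 'X_{1..n}) m :
  monom_ideal (K := K) M 'X_[m] -> exists2 k, M k & (k <= m)%MM.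
Proof.
pose D := [set F : {mpoly K[n]} |
  forall l, l \in msupp F -> exists2 k, M k & (k <= l)%MM].
suff sub : monom_ideal M `<=` D by move=> /sub; apply; rewrite msuppX mem_head.
apply: ideal_gen_min; last first.
  by move=> _ [k Mk <-] l; rewrite msuppX inE => /eqP ->; exists k; last exact: lepm_refl.
split=> [l|F G DF DG l|F G DG l]; first by rewrite msupp0.
  by move/msuppD_le; rewrite mem_cat => /orP[/DF|/DG].
move/msuppM_le/allpairsP => [[l1 l2] /= [_ /DG[k Mk kl] ->]].
by exists k => //; apply: lepm_trans kl (lem_addl _ _).
Qed.

Lemma monom_ideal_mem (K : fieldType) n (M : set 'X_{1..n}) k m :
  M k -> (k <= m)%MM -> monom_ideal (K := K) M 'X_[m].
Proof.
move=> Mk /submK <-; rewrite mpolyXD; apply: (ideal_mull _ (is_ideal_gen _)).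
by apply: sub_ideal_gen; exists k.
Qed.

Lemma squarefree_monomial_ideal_root (K : fieldType) n (le : rel 'X_{1..n})
    (J : set {mpoly K[n]}) :
  monomial_order le -> is_ideal J ->
  (forall u k, lead_monoms le J (u *+ k)%MM -> lead_monoms le J u) ->
  squarefree_monomial_ideal (initial_ideal le J).
Proof.
move=> mo iJ root.
exists [set m | squarefree_monom m /\ lead_monoms le J m]; first by move=> m [].
apply/seteqP; split; last first.
  by apply: ideal_gen_sub => _ [m [_ Jm] <-]; exists m.
apply: (ideal_gen_min (is_ideal_gen _)) => _ [m Jm <-].
(* The product of the variables dividing [m]; its power [mdeg m] is divisible by [m]. *)
pose u : 'X_{1..n} := [multinom minn (m i) 1 | i < n].
apply: (monom_ideal_mem (k := u)); last first.
  by apply/mnm_lepP => i; rewrite mnmE geq_minl.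
split; first by move=> i; rewrite mnmE geq_minr.
apply: (root u (mdeg m)); apply: (lead_monoms_dvd mo iJ Jm).
apply/mnm_lepP => i; rewrite mulmnE mnmE.
case: (posnP (m i)) => [->|mi]; first by rewrite min0n.
by rewrite (minn_idPr mi) mul1n mdegE (bigD1 i) //= leq_addr.
Qed.

Theorem theorem3p13 (K : fieldType) (n : nat) (I : set {mpoly K[n]})
    (le : rel 'X_{1..n}) (h : nat) :
  is_ideal I ->
  monomial_order le ->
  max_height_min_primes I h ->
  (exists2 m : 'X_{1..n}, squarefree_monom m &
     initial_ideal le (symbolic_power I h) 'X_[m]) ->
  squarefree_monomial_ideal (initial_ideal le (radical I)).
Proof.
move=> iI mo [_ heightI] [m sqm /monom_ideal_dvd[k [f [x nPx Ifx] fk] km]].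
have k1 : (k <= ones n)%MM.
  apply/mnm_lepP => i; rewrite mnmE; apply: leq_trans (sqm i).
  by move/mnm_lepP: km.
apply: (squarefree_monomial_ideal_root mo (is_ideal_radical iI)) => u j.
(* The leading monomial [k] of [f] divides a squarefree one, hence the product of all variables; [g]
   is the monic multiple of [f] led by that product, with the same multiplier [x]. *)
pose g := 'X_[ones n - k] * ((f@_k)^-1 *: f).
apply: (lead_radical_root mo iI heightI (f := g) nPx).
  have -> : g * x = 'X_[ones n - k] * (f@_k)^-1%:MP * (f * x).
    by rewrite /g -mul_mpolyC; ring.
  by apply: ideal_mull => //; apply: is_ideal_exp.
rewrite -(submK k1); apply: (monic_atM mo); first exact: monic_atX.
exact: initial_monic.
Qed.
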